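(* Let $m\ge2$ and let $\mathcal{H}\in\mathcal{P}(\mathcal{H})$ be a connected $3$-cyclic Type II linear $m$-uniform hypergraph with $k$ edges, where $(k-13)(m-1)\ge46$. If $\mathcal{H}\ne T_2C(c_1=k-9)$, then $\lambda_1(\mathcal{H})\le\lambda_1(T_2C(c_1=k-10,c_2=1))$, and equality holds only when $\mathcal{H}=T_2C(c_1=k-10,c_2=1)$.
   Context: A hypergraph has a finite vertex set and an edge set of non-empty subsets of the vertex set; it is $m$-uniform if all edges have cardinality $m$, and linear if two distinct edges share at most one vertex. The adjacency matrix of a linear $m$-uniform hypergraph has $(i,j)$ entry $\frac{1}{m-1}$ if $i\ne j$ lie in a common edge, and $0$ otherwise; $\lambda_1$ denotes the spectral radius of this matrix. The $m$-th power hypergraph of a graph $G(V,E)$ is the $m$-uniform hypergraph obtained by adding to each edge $e\in E$ $m-2$ new vertices $v_{e,1},\dots,v_{e,m-2}$ (distinct for distinct edges). $\mathcal{P}(\mathcal{H})$ denotes the set of $m$-th power hypergraphs of graphs (a fixed notation for the set, not depending on the particular hypergraph $\mathcal{H}$). A loose cycle of length $l\ge3$, $v_1e_1v_2e_2\dots v_le_lv_1$, is the $m$-uniform hypergraph with edges $e_1,\dots,e_l$ in which $e_{i-1}\cap e_i=\{v_i\}$ (indices mod $l$, the $v_i$ distinct) and non-consecutive edges are disjoint. A linear hypergraph is $3$-cyclic if it contains exactly three loose cycles. An $m$-uniform $3$-cyclic linear hypergraph with $n$ vertices and $k$ edges is of Type II if $n=k(m-1)-2$. Attaching a pendant edge at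 a vertex $v$ means adding a new edge consisting of $v$ and $m-1$ new vertices. $T_2C(c_1=l_1,\dots,c_7=l_7)$ is the hypergraph consisting of three loose cycles of length $3$, $v_1e_1v_2e_2v_3e_3v_1$, $v_1e_4v_4e_5v_5e_6v_1$ and $v_1e_7v_6e_8v_7e_9v_1$, pairwise sharing only the vertex $v_1$, together with $l_i$ pendant edges attached at $v_i$ for $i=1,\dots,7$; when only some of the $c_i$ are listed, the others are $0$. Equality of hypergraphs means isomorphism. *)

(* Defs.v *)
From HB Require Import structures.
From mathcomp Require Import all_boot all_order all_algebra.

Set Implicit Arguments.
Unset Strict Implicit.
Unset Printing Implicit Defensive.

Import Order.TTheory GRing.Theory Num.Theory.
Local Open Scope ring_scope.

Record hypergraph := Hypergraph {
  vert : finType;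
  edges : {set {set vert}};
  edges_neq0 : set0 \notin edges
}.

Definition hiso (H1 H2 : hypergraph) : Prop :=
  exists2 f : vert H1 -> vert H2,
    bijective f & [set f @: (e : {set vert H1}) | e in edges H1] = edges H2.

Definition uniform (m : nat) (H : hypergraph) : bool :=
  [forall e in edges H, #|e| == m].

Definition linear_hypergraph (H : hypergraph) : bool :=
  [forall e in edges H, forall f in edges H, (e != f) ==> (#|e :&: f| <= 1)%N].

Definition in_common_edge (H : hypergraph) : rel (vert H) :=
  fun x y => [exists e in edges H, (x \in e) && (y \in e)].

Definition hconnected (H : hypergraph) : Prop :=
  forall x y : vert H, connect (@in_common_edge H) x y.

(* Rows and columns are indexed by the enumeration of the vertex set. *)
Definition adjacency (C : numClosedFieldType) (m : nat) (H : hypergraph) :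
    'M[C]_#|vert H| :=
  \matrix_(i, j)
    if (i != j) && in_common_edge (enum_val i) (enum_val j)
    then (m - 1)%:R^-1 else 0.

(* All roots in C of the characteristic polynomial, with multiplicity. *)
Definition eigenvalues (C : numClosedFieldType) (n : nat) (A : 'M[C]_n) : seq C :=
  sval (closed_field_poly_normal (char_poly A)).

Lemma mem_eigenvalues (C : numClosedFieldType) (n : nat) (A : 'M[C]_n) (z : C) :
  (z \in eigenvalues A) = eigenvalue A z.
Proof.
rewrite eigenvalue_root_char /eigenvalues.
case: closed_field_poly_normal => r /= ->.
by rewrite (monicP (char_poly_monic A)) scale1r root_prod_XsubC.
Qed.

Definition spectral_radius (C : numClosedFieldType) (n : nat) (A : 'M[C]_n) : C :=
  \big[Num.max/0]_(z <- eigenvalues A) `|z|.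

Definition lambda1 (C : numClosedFieldType) (m : nat) (H : hypergraph) : C :=
  spectral_radius (adjacency C m H).

(* Simple graphs are the 2-uniform hypergraphs; the new vertex v_{e,j+1} is
   inr (e, j). *)
Section Power.
Variables (m : nat) (G : hypergraph).

Let power_vert : finType := (vert G + {e | e \in edges G} * 'I_(m - 2))%type.

Definition power_edge (e : {e | e \in edges G}) : {set power_vert} :=
  [set inl x | x in val e] :|: [set inr (e, j) | j : 'I_(m - 2)].

Lemma power_edges_neq0 : set0 \notin [set power_edge e | e : {e | e \in edges G}].
Proof.
apply/imsetP => -[[e eG] _ /esym/eqP].
rewrite setU_eq0 => /andP[/eqP e0 _].
have /set0Pn[x xe] : e != set0.
  by apply: contraNneq (edges_neq0 G) => <-.
by have := in_set0 (inl x : power_vert); rewrite -e0 imset_f.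
Qed.

Definition power_hypergraph : hypergraph := Hypergraph power_edges_neq0.

End Power.

Definition is_power_hypergraph (m : nat) (H : hypergraph) : Prop :=
  exists2 G : hypergraph, uniform 2%N G & hiso H (power_hypergraph m G).

(* A loose cycle v_1 e_1 v_2 e_2 ... v_l e_l v_1, recorded by its edge set c;
   its length is l = #|c|, and ord_pred and ordS are the predecessor and the
   successor modulo l. *)
Definition loose_cycle (V : finType) (c : {set {set V}}) : bool :=
  (2 < #|c|)%N &&
  [exists v : {ffun 'I_#|c| -> V}, exists e : {ffun 'I_#|c| -> {set V}},
    [&& c == [set e i | i : 'I_#|c|],
        injectiveb v,
        [forall i, e (ord_pred i) :&: e i == [set v i]]
      & [forall i, forall j,
           [|| j == i, j == ordS i, i == ordS j | [disjoint e i & e j]]]]].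

Definition three_cyclic (H : hypergraph) : bool :=
  #|[set c : {set {set vert H}} | (c \subset edges H) && loose_cycle c]| == 3%N.

Definition type_II (m : nat) (H : hypergraph) : bool :=
  #|vert H| == (#|edges H| * (m - 1) - 2)%N.

(* T_2C(c_1 = l_1, ..., c_7 = l_7), where l is the list l_1, ..., l_7 and
   entries missing from l are 0. Indices start at 0: i : 'I_7 stands for
   v_{i+1} and j : 'I_9 for e_{j+1}. The vertices are v_1, ..., v_7, the m - 2
   remaining vertices of each cycle edge, and the m - 1 new vertices of each
   pendant edge, a pendant edge being a pair of its vertex v_i and its number
   among those attached at v_i. *)
Section T2C.
Variables (m : nat) (l : seq nat).

Definition T2C_ends (j : 'I_9) : {set 'I_7} :=
  [set i : 'I_7 | (i : nat) \in nth [::]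
    [:: [:: 0; 1]; [:: 1; 2]; [:: 2; 0];
        [:: 0; 3]; [:: 3; 4]; [:: 4; 0];
        [:: 0; 5]; [:: 5; 6]; [:: 6; 0]]%N j].

Definition T2C_pendant : finType := {i : 'I_7 & 'I_(nth 0%N l i)}.

Definition T2C_vert : finType :=
  ('I_7 + 'I_9 * 'I_(m - 2) + T2C_pendant * 'I_(m - 1))%type.

Definition T2C_cycle_edge (j : 'I_9) : {set T2C_vert} :=
  [set inl (inl i) | i in T2C_ends j] :|:
  [set inl (inr (j, t)) | t : 'I_(m - 2)].

Definition T2C_pendant_edge (p : T2C_pendant) : {set T2C_vert} :=
  inl (inl (tag p)) |: [set inr (p, t) | t : 'I_(m - 1)].

Definition T2C_edges : {set {set T2C_vert}} :=
  [set T2C_cycle_edge j | j : 'I_9] :|: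
  [set T2C_pendant_edge p | p : T2C_pendant].

Lemma T2C_edges_neq0 : set0 \notin T2C_edges.
Proof.
apply/setUP => -[] /imsetP[x _ /esym/eqP]; last first.
  by rewrite setU_eq0 -cards_eq0 cards1.
rewrite setU_eq0 => /andP[/eqP x0 _].
suff /set0Pn[i ix] : T2C_ends x != set0.
  by have := in_set0 (inl (inl i) : T2C_vert); rewrite -x0 imset_f.
apply/set0Pn.
by case: x {x0} => -[|[|[|[|[|[|[|[|[|//]]]]]]]]] x9;
  [exists (inord 0) | exists (inord 1) | exists (inord 2)
  |exists (inord 3) | exists (inord 3) | exists (inord 4)
  |exists (inord 5) | exists (inord 5) | exists (inord 6)];
  rewrite inE /= inordK.
Qed.

Definition T2C : hypergraph := Hypergraph T2C_edges_neq0.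

End T2C.

(* Main.v *)
Require Import Defs.
From HB Require Import structures.
From mathcomp Require Import all_boot all_order all_algebra.
From mathcomp Require Import ring lra zify.

Set Implicit Arguments.
Unset Strict Implicit.
Unset Printing Implicit Defensive.

Import Order.TTheory GRing.Theory Num.Theory.
Local Open Scope ring_scope.

(* Eliminating the new vertices turns an eigenvector of the power hypergraph of a
   graph G, for the eigenvalue l, into a vector x on the vertices of G with
     t x_u = sum_(w ~ u) x_w + e (deg u - 1) x_u,
   where t = (m - 1) l - (m - 2) and e = (m - 2) / (t + m - 1) lies in [0, 1).
   Let x be a Perron vector with maximum x_v = 1, and let r be the number of
   vertices neither equal nor adjacent to v. Since G has two more edges than
   vertices and at most three cycles, there are few triangles and 4-cycles
   through v, so iterating the equation twice at v bounds t from above in terms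
   of deg v = k - 3 - r. If r >= 2, or if r = 1 and G is not the graph of
   T_2C(c_1 = k - 10, c_2 = 1), this bound makes an explicit vector on
   T_2C(c_1 = k - 10, c_2 = 1) a strict subsolution of the eigenvalue equation
   for l, whence l is smaller than its spectral radius. If r = 0, the graph is
   that of T_2C(c_1 = k - 9). *)

(** * The real subfield of a numerically closed field *)

(** The spectral radius of the target [T2C] is never computed; it is only bounded below, and the
    comparison is organized around the hub [v]. Iterating at [v] gives
    [t^2 - e t (d - 1) = d + hub_excess] with [d = k - 3 - r], while the hub of the target has
    degree [k - 4]. A deficit of [r - 1] neighbours therefore costs [(r - 1)(1 + e t)], and the
    question becomes whether [hub_excess] stays below this cost plus the contribution of the three
    triangles of the target. Now [k] has disappeared: for [r >= 2] there remains a family of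
    polynomial inequalities in [e] and [t], which fail for small [t]. Small [t] is treated without
    looking at [G]. The graph of the target contains a star with [k - 4] edges, and
    [(k - 13)(m - 1) >= 46] makes this star alone beat every [t < 37/5 + e]. For [m = 2] the star
    has at least 55 edges, and 37/5 lies just below the square root of 55. *)

Record realC (C : numClosedFieldType) :=
  RealC {realC_val :> C; realC_valP : realC_val \is Num.real}.

Section RealSubfield.
Variable C : numClosedFieldType.

HB.instance Definition _ := [isSub for @realC_val C].
HB.instance Definition _ := [Choice of realC C by <:].
HB.instance Definition _ := [SubChoice_isSubIntegralDomain of realC C by <:].
HB.instance Definition _ := [SubIntegralDomain_isSubField of realC C by <:].
(** The order is pulled back along [realC_val], so an inequality in [realC C] is convertible with
    the one in [C]. The gain over [C] is totality, on which [lra], [nra] and the choice of a vertex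
    of maximal weight depend. *)
HB.instance Definition _ : Order.isPOrder ring_display (realC C) :=
  Order.CancelPartial.Pcan _ (@valK _ _ (realC C)).

Fact realC_total : total (<=%O : rel (realC C : porderType _)).
Proof. by move=> x y; apply/real_leVge/valP/valP. Qed.
HB.instance Definition _ :=
  Order.POrder_isTotal.Build ring_display (realC C) realC_total.

Fact realC_val_zmod : zmod_morphism (@realC_val C). Proof. by []. Qed.
Fact realC_val_monoid : monoid_morphism (@realC_val C). Proof. by []. Qed.
HB.instance Definition _ :=
  GRing.isZmodMorphism.Build (realC C) C (@realC_val C) realC_val_zmod.
HB.instance Definition _ :=
  GRing.isMonoidMorphism.Build (realC C) C (@realC_val C) realC_val_monoid.

Definition realC_norm (x : realC C) : realC C := RealC (normr_real (val x)).

Fact realC_ler_normD x y : realC_norm (x + y) <= realC_norm x + realC_norm y.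
Proof. exact: (ler_normD (val x) (val y)). Qed.
Fact realC_normr0_eq0 x : realC_norm x = 0 -> x = 0.
Proof. by move=> /(congr1 val)/normr0_eq0 ?; apply/val_inj. Qed.
Fact realC_normrMn x n : realC_norm (x *+ n) = realC_norm x *+ n.
Proof.
apply/val_inj; rewrite /= -[val _]/(realC_val _).
by rewrite !rmorphMn /= normrMn.
Qed.
Fact realC_normrN x : realC_norm (- x) = realC_norm x.
Proof. by apply/val_inj; apply: (normrN (val x)). Qed.
Fact realC_addr_gt0 (x y : realC C) : 0 < x -> 0 < y -> 0 < x + y.
Proof. exact: (@addr_gt0 _ (val x) (val y)). Qed.
Fact realC_ger_leVge (x y : realC C) : 0 <= x -> 0 <= y -> (x <= y) || (y <= x).
Proof. by move=> *; apply: realC_total. Qed.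
Fact realC_normrM : {morph realC_norm : x y / x * y}.
Proof. by move=> x y; apply/val_inj; apply: (normrM (val x) (val y)). Qed.
Fact realC_ler_def (x y : realC C) : (x <= y) = (realC_norm (y - x) == y - x).
Proof. exact: (ler_def (val x) (val y)). Qed.

HB.instance Definition _ := Num.Zmodule_isNormed.Build _ (realC C)
  realC_ler_normD realC_normr0_eq0 realC_normrMn realC_normrN.
HB.instance Definition _ := Num.isNumRing.Build (realC C)
  realC_addr_gt0 realC_ger_leVge realC_normrM realC_ler_def.

End RealSubfield.

(** * Spectral radius of a real symmetric matrix *)

Section SymmetricMatrix.
Local Open Scope sesquilinear_scope.
Variables (C : numClosedFieldType) (n : nat).
Implicit Types (A P : 'M[C]_n) (u : 'rV[C]_n).

Let sqn u : C := \sum_j `|u 0 j| ^+ 2.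

Let sqnE u : sqn u = (u *m u ^t*) 0 0.
Proof. by rewrite mxE; apply: eq_bigr => j _; rewrite !mxE normCK. Qed.

Let sqn_unitary P u : P \is unitarymx -> sqn (u *m P) = sqn u.
Proof.
by move=> Pu; rewrite !sqnE trmx_mul map_mxM mulmxA mulmxtVK.
Qed.

Lemma norm_eigenvalue_le A a : eigenvalue A a -> `|a| <= spectral_radius A.
Proof.
rewrite -mem_eigenvalues /spectral_radius.
(* In a partial order [Num.max] is an upper bound only for comparable arguments, so the partial
   maxima must be known to be real. *)
have bigmax_real s : \big[Num.max/0]_(y <- s) `|y| \is @Num.real C.
  by elim: s => [|y s IH]; rewrite ?big_nil // big_cons max_real ?normr_real.
elim: (eigenvalues A) => //= z s IH.
rewrite big_cons inE comparable_le_max ?real_comparable ?normr_real //.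
by case/predU1P => [->|/IH->]; rewrite ?lexx ?orbT.
Qed.

Lemma spectral_radius_eigenvalue A : (0 < n)%N ->
  exists2 a, eigenvalue A a & spectral_radius A = `|a|.
Proof.
move=> n_gt0; rewrite /spectral_radius.
have [a0]: exists a, a \in eigenvalues A.
  have [a ev_a] := eigenvalue_closed A n_gt0.
  by exists a; rewrite mem_eigenvalues.
suff: forall s : seq C, a0 \in s ->
    exists2 a, a \in s & \big[Num.max/0]_(z <- s) `|z| = `|a|.
  move=> P /P[a a_in ->]; exists a => //.
  by rewrite -mem_eigenvalues.
move=> s; elim: s a0 => // z s IH a0 _; rewrite big_cons.
case: s IH => [_|y s IH].
  exists z; rewrite ?mem_head // big_nil.
  by rewrite /Order.max normr_lt0.
have [a a_in ->] := IH y (mem_head _ _).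
case: (@real_leP _ `|z| `|a| (normr_real _) (normr_real _)) => _.
  by exists a => //; rewrite inE a_in orbT.
by exists z => //; rewrite mem_head.
Qed.

Lemma spectral_radius_ge0 A : 0 <= spectral_radius A.
Proof.
rewrite /spectral_radius; elim: (eigenvalues A) => [|z s IH].
  by rewrite big_nil.
by rewrite big_cons /Order.max; case: ifP.
Qed.

(** A real symmetric matrix is unitarily diagonalizable. Unitary matrices preserve [sqn], and the
    diagonal matrix stretches each coordinate by the modulus of an eigenvalue. *)
Lemma sqnorm_mulmx_le A u : A \is symmetricmx -> A \is a realmx ->
  sqn (u *m A) <= spectral_radius A ^+ 2 * sqn u.
Proof.
move=> Asym Areal; have Anorm := symmetric_normalmx Asym Areal.
have := orthomx_spectralP Anorm.
set P := spectralmx A; set d := spectral_diag A => defA.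
have Pu : P \is unitarymx := spectral_unitarymx A.
have Pi : invmx P \is unitarymx by rewrite invmx_unitary // trmxC_unitary.
have Pun := unitarymx_unit Pu.
have d_le j : `|d 0 j| <= spectral_radius A.
  apply: norm_eigenvalue_le; apply/eigenvalueP.
  (* The rows of [P] are eigenvectors; a zero row would make the determinant of [P] vanish. *)
  exists (row j P); last first.
    apply: contraTneq Pun => Pj0; rewrite unitmxE unitfE.
    rewrite (expand_det_row _ j) big1 ?eqxx // => i _.
    by move/rowP: Pj0 => /(_ i); rewrite !mxE => ->; rewrite mul0r.
  rewrite -row_mul {1}defA !mulmxA mulmxV // mul1mx.
  by rewrite row_mul row_diag_mx -scalemxAl -rowE.
rewrite {1}defA !mulmxA sqn_unitary //.
rewrite -(sqn_unitary u Pi); set w := u *m _.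
rewrite /sqn mulr_sumr ler_sum // => j _.
rewrite mul_mx_diag mxE normrM exprMn mulrC.
by rewrite ler_wpM2r ?exprn_ge0 // lerXn2r ?nnegrE ?spectral_radius_ge0.
Qed.

(* If [z] is an eigenvector for an eigenvalue of maximal modulus, then
   [`|z| A >= rho `|z|] entrywise, and the norm bound forces equality. *)
Lemma nonneg_eigenvector A : (0 < n)%N -> A \is symmetricmx ->
  (forall i j, 0 <= A i j) ->
  exists u : 'rV[C]_n, [/\ forall j, 0 <= u 0 j, u != 0
    & u *m A = spectral_radius A *: u].
Proof.
move=> n_gt0 Asym A_ge0.
have Areal : A \is a realmx by apply/mxOverP => i j; rewrite ger0_real.
have [a /eigenvalueP[z zA z_neq0] rhoE] := spectral_radius_eigenvalue A n_gt0.
pose u := map_mx Num.norm z; exists u.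
have u_ge0 j : 0 <= u 0 j by rewrite mxE.
have uA_ge j : spectral_radius A * u 0 j <= (u *m A) 0 j.
  rewrite rhoE !mxE -normrM.
  have <- : (z *m A) 0 j = a * z 0 j by rewrite zA mxE.
  rewrite mxE; apply: le_trans (ler_norm_sum _ _ _) _.
  by apply: ler_sum => i _; rewrite normrM mxE (ger0_norm (A_ge0 _ _)).
split=> //.
  apply: contraNneq z_neq0 => /rowP u0; apply/eqP/rowP => j.
  by have := u0 j; rewrite !mxE => /normr0_eq0.
have uA_ge0 j : 0 <= spectral_radius A * u 0 j.
  by rewrite mulr_ge0 ?spectral_radius_ge0.
pose gap j := `|(u *m A) 0 j| ^+ 2 - (spectral_radius A * `|u 0 j|) ^+ 2.
have gap_ge0 j : 0 <= gap j.
  rewrite subr_ge0 (ger0_norm (u_ge0 _)) lerXn2r ?nnegrE //.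
  by rewrite ger0_norm ?uA_ge // (le_trans _ (uA_ge j)).
have : \sum_j gap j == 0.
  rewrite eq_le sumr_ge0 // andbT sumrB subr_le0.
  apply: le_trans (sqnorm_mulmx_le u Asym Areal) _.
  by rewrite /sqn mulr_sumr; under eq_bigr do rewrite -exprMn.
rewrite psumr_eq0 // => /allP gap0; apply/rowP => j; rewrite [RHS]mxE.
have /= := gap0 j (mem_index_enum _); rewrite subr_eq0 (ger0_norm (u_ge0 _)).
rewrite eqrXn2 // => /eqP <-.
by rewrite ger0_norm // (le_trans (uA_ge0 j) (uA_ge j)).
Qed.

(** Strictness at a single coordinate is enough because the comparison is made between norms:
    [s^2 sqn u < sqn (u A)], and the right side is at most the squared spectral radius times
    [sqn u]. *)
Lemma spectral_radius_gt A (u : 'rV[C]_n) (s : C) : A \is symmetricmx ->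
  (forall i j, 0 <= A i j) -> 0 <= s -> (forall j, 0 <= u 0 j) ->
  (forall j, s * u 0 j <= (u *m A) 0 j) ->
  (exists j, s * u 0 j < (u *m A) 0 j) -> s < spectral_radius A.
Proof.
move=> Asym A_ge0 s_ge0 u_ge0 uA_ge [j0 uA_gt].
have Areal : A \is a realmx by apply/mxOverP => i j; rewrite ger0_real.
have su_ge0 j : 0 <= s * u 0 j by rewrite mulr_ge0.
have uA_ge0 j : 0 <= (u *m A) 0 j := le_trans (su_ge0 j) (uA_ge j).
have lt_sqn : s ^+ 2 * sqn u < sqn (u *m A).
  rewrite /sqn mulr_sumr (bigD1 j0) //= [X in _ < X](bigD1 j0) //=.
  apply: ltr_leD; last first.
    apply: ler_sum => j _; rewrite !ger0_norm // -exprMn.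
    by rewrite lerXn2r ?nnegrE.
  by rewrite !ger0_norm // -exprMn ltrXn2r ?nnegrE.
have := lt_le_trans lt_sqn (sqnorm_mulmx_le u Asym Areal).
have sqn_ge0 : 0 <= sqn u by apply: sumr_ge0 => j _; rewrite exprn_ge0.
rewrite real_ltNge ?ger0_real ?mulr_ge0 ?exprn_ge0 ?spectral_radius_ge0 //.
rewrite (real_ltNge (ger0_real s_ge0)) ?ger0_real ?spectral_radius_ge0 //.
apply: contra => le_s; rewrite ler_wpM2r // lerXn2r ?nnegrE //.
exact: spectral_radius_ge0.
Qed.

End SymmetricMatrix.

(** * Perron vectors of hypergraphs *)

Lemma in_common_edge_sym (H : hypergraph) : symmetric (@in_common_edge H).
Proof.
by move=> x y; apply: eq_existsb => e; rewrite [(x \in e) && _]andbC.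
Qed.

(** The adjacency operator without its factor [1 / (m - 1)]; the eigenvalue for [l] is then
    [(m - 1) l = t + (m - 2)]. *)
Definition adj_sum (R : nmodType) (H : hypergraph) (y : vert H -> R)
    (z : vert H) : R :=
  \sum_(w | (w != z) && in_common_edge w z) y w.

Section HypergraphSpectrum.
Variables (C : numClosedFieldType) (m : nat) (H : hypergraph).
Let A := adjacency C m H.

Let A_sym : A \is symmetricmx.
Proof.
apply/is_hermitianmxP; rewrite expr0 scale1r; apply/matrixP => i j.
by rewrite !mxE eq_sym in_common_edge_sym.
Qed.

Let A_ge0 i j : 0 <= A i j.
Proof. by rewrite mxE; case: ifP => // _; rewrite invr_ge0 ler0n. Qed.

Let mulmx_adjacency (u : 'rV[C]_#|vert H|) (j : 'I_#|vert H|) :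
  (u *m A) 0 j =
  (m - 1)%:R^-1 * adj_sum (fun z => u 0 (enum_rank z)) (enum_val j).
Proof.
rewrite mxE /adj_sum [in RHS]big_mkcond mulr_sumr.
rewrite [RHS](reindex (@enum_val (vert H) (vert H))) /=; last first.
  by apply: onW_bij; apply: enum_val_bij.
apply: eq_bigr => i _; rewrite mxE enum_valK.
by rewrite (can_eq enum_valK); case: ifP => _; rewrite ?mulr0 // mulrC.
Qed.

Hypothesis m_ge2 : (2 <= m)%N.
Let m1_gt0 (R : numDomainType) : 0 < (m - 1)%:R :> R.
Proof. by rewrite ltr0n subn_gt0. Qed.

Let val_adj_sum (y : vert H -> realC C) z :
  val (adj_sum y z) = adj_sum (fun w => val (y w)) z.
Proof. exact: (raddf_sum (@realC_val C)). Qed.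

Lemma perron_vector (z0 : vert H) : exists l : realC C, exists x : vert H -> realC C,
  [/\ val l = lambda1 C m H, forall z, 0 <= x z, exists z, 0 < x z
    & forall z, adj_sum x z = (m - 1)%:R * l * x z].
Proof.
have n_gt0 : (0 < #|vert H|)%N by apply/card_gt0P; exists z0.
have [u [u_ge0 u_neq0 uA]] := nonneg_eigenvector n_gt0 A_sym A_ge0.
exists (RealC (ger0_real (spectral_radius_ge0 A))).
exists (fun z => RealC (ger0_real (u_ge0 (enum_rank z)))).
split=> // [z||z].
- exact: (u_ge0 (enum_rank z)).
- have [j uj_neq0] : exists j, u 0 j != 0.
    apply/existsP; apply: contraR u_neq0 => /existsPn u0.
    by apply/eqP/rowP => j; rewrite mxE; apply/eqP; have := u0 j; rewrite negbK.
  exists (enum_val j); suff : 0 < u 0 (enum_rank (enum_val j)) by [].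
  by rewrite enum_valK lt_def uj_neq0 u_ge0.
- apply: val_inj; rewrite val_adj_sum.
  rewrite -[RHS]/(realC_val _) rmorphM rmorphM rmorph_nat /=.
  have := mulmx_adjacency u (enum_rank z); rewrite enum_rankK uA mxE.
  by move/(canLR (mulVKf (lt0r_neq0 (m1_gt0 C)))) => <-; rewrite mulrA.
Qed.

Lemma lambda1_gt (y : vert H -> realC C) (s : realC C) :
  0 <= s -> (forall z, 0 <= y z) ->
  (forall z, (m - 1)%:R * s * y z <= adj_sum y z) ->
  (exists z, (m - 1)%:R * s * y z < adj_sum y z) ->
  val s < lambda1 C m H.
Proof.
move=> s_ge0 y_ge0 y_sub [z0 y_strict].
pose u : 'rV[C]_#|vert H| := \row_j val (y (enum_val j)).
have uE z : adj_sum (fun w => u 0 (enum_rank w)) z = val (adj_sum y z).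
  by rewrite val_adj_sum; apply: eq_bigr => w _; rewrite mxE enum_rankK.
have mE z : val ((m - 1)%:R * s * y z) = (m - 1)%:R * (val s * val (y z)).
  by rewrite -[LHS]/(realC_val _) !rmorphM rmorph_nat /= mulrA.
apply: (@spectral_radius_gt _ _ A u) => //.
- by move=> j; rewrite mxE; apply: y_ge0.
- move=> j; rewrite mulmx_adjacency uE mxE -ler_pdivrMl ?invr_gt0 ?m1_gt0 //.
  by rewrite invrK -mE; apply: y_sub.
- exists (enum_rank z0); rewrite mulmx_adjacency uE mxE enum_rankK.
  by rewrite -ltr_pdivrMl ?invr_gt0 ?m1_gt0 // invrK -mE; apply: y_strict.
Qed.

End HypergraphSpectrum.

(** * Graphs and their power hypergraphs *)

Lemma set2_injr (V : finType) (a b c : V) : [set a; b] = [set a; c] -> b = c.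
Proof.
move=> eq_ab_ac.
have : c \in [set a; b] by rewrite eq_ab_ac set22.
have : b \in [set a; c] by rewrite -eq_ab_ac set22.
by rewrite !inE => /orP[]/eqP-> // /orP[]/eqP->.
Qed.

Lemma card2_setP (V : finType) (e : {set V}) (a : V) :
  #|e| = 2%N -> a \in e -> exists2 b, b != a & e = [set a; b].
Proof.
move=> e2 ae; have /eqP/cards1P[b eb] : #|e :\ a| = 1%N.
  by have := cardsD1 a e; rewrite e2 ae => -[].
exists b; last by rewrite -eb setD1K.
by have := set11 b; rewrite -eb !inE => /andP[].
Qed.

Section TwoSets.
Variables (V : finType) (E : {set {set V}}).
Hypothesis E2 : forall e, e \in E -> #|e| = 2%N.

Lemma edge_irrefl a : [set a; a] \notin E.
Proof. by apply/negP => /E2; rewrite setUid cards1. Qed.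

Lemma edge_neq a b : [set a; b] \in E -> a != b.
Proof. by apply: contraTneq => <-; apply: edge_irrefl. Qed.

Lemma sum_incident (R : nmodType) (a : V) (F : {set V} -> R) :
  \sum_(e in E | a \in e) F e = \sum_(b | [set a; b] \in E) F [set a; b].
Proof.
(* Inverse of [b |-> {a, b}] on the edges at [a]; the default is never reached there, since an edge
   has a second element. *)
pose other (e : {set V}) := odflt a [pick b in e :\ a].
rewrite (reindex_onto (fun b => [set a; b]) other).
  apply: eq_bigl => b; rewrite !inE eqxx andbT /=.
  case: (boolP (_ \in E)) => //= /edge_neq ab.
  rewrite /other; case: pickP => [c|/(_ b)] /=; rewrite !inE.
    by case/andP => /negPf-> /= /eqP->; rewrite eqxx.
  by rewrite eq_sym ab eqxx orbT.
move=> e /andP[/E2 e2 ae]; have [b b_neq ->] := card2_setP e2 ae.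
rewrite /other; case: pickP => [c|/(_ b)] /=; rewrite !inE.
  by case/andP => /negPf-> /= /eqP->.
by rewrite b_neq eqxx orbT.
Qed.

(** The handshake lemma, stated for any set of pairs because it serves both for all edges of a graph
    and for [hub_triangles]. *)
Lemma sum_degrees : (\sum_a #|[set b | [set a; b] \in E]| = 2 * #|E|)%N.
Proof.
have -> : (2 * #|E| = \sum_(e in E) #|e|)%N.
  by rewrite (eq_bigr (fun=> 2%N)) ?sum_nat_const 1?mulnC.
rewrite (eq_bigr (fun e : {set V} => \sum_(a in e) 1)%N); last first.
  by move=> e _; rewrite sum1_card.
rewrite (exchange_big_dep xpredT) //=; apply: eq_bigr => a _.
rewrite -sum1_card (sum_incident a (fun=> 1%N)).
by apply: eq_bigl => b; rewrite inE.
Qed.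

End TwoSets.

Definition gadj (G : hypergraph) : rel (vert G) :=
  fun a b => [set a; b] \in edges G.

Lemma gadj_sym G : symmetric (@gadj G).
Proof. by move=> a b; rewrite /gadj setUC. Qed.

Lemma uniformP m H : reflect (forall e, e \in edges H -> #|e| = m) (uniform m H).
Proof.
apply: (iffP forallP) => H_m e; first by move=> eH; apply/eqP/(implyP (H_m e)).
by apply/implyP => /H_m ->.
Qed.

Lemma hiso_sym H1 H2 : hiso H1 H2 -> hiso H2 H1.
Proof.
move=> [f [g fK gK] eH2]; exists g; first by exists f.
apply/setP => e; apply/imsetP/idP => [[e2]|eH1].
  rewrite -eH2 => /imsetP[e1 e1H ->] ->.
  by rewrite -imset_comp (eq_imset _ fK) imset_id.
by exists (f @: e); rewrite -?eH2 ?imset_f // -imset_comp (eq_imset _ fK) imset_id.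
Qed.

Lemma hiso_trans H1 H2 H3 : hiso H1 H2 -> hiso H2 H3 -> hiso H1 H3.
Proof.
move=> [f fb eH2] [g gb eH3]; exists (g \o f); first exact: bij_comp.
rewrite -eH3 -eH2 -imset_comp; apply: eq_imset => e /=.
by rewrite imset_comp.
Qed.

Lemma adj_sum_hiso (R : nmodType) H1 H2 (f : vert H1 -> vert H2) (y : vert H2 -> R) z :
  bijective f -> [set f @: (e : {set vert H1}) | e in edges H1] = edges H2 ->
  adj_sum (y \o f) z = adj_sum y (f z).
Proof.
move=> fb eH2; have f_inj := bij_inj fb.
rewrite /adj_sum [RHS](reindex f); last exact: onW_bij.
apply: eq_bigl => w; rewrite (inj_eq f_inj); congr (_ && _).
apply/existsP/existsP => -[e /and3P[eH we ze]].
  by exists (f @: e); rewrite -eH2 !imset_f.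
move: eH we ze; rewrite -eH2 => /imsetP[e1 e1H ->].
by rewrite !mem_imset // => we ze; exists e1; rewrite e1H we.
Qed.

Section PowerSpectrum.
Variables (R : realFieldType) (m : nat) (G : hypergraph).
Hypothesis G2 : uniform 2 G.
Let E2 := uniformP 2 G G2.
Let P := power_hypergraph m G.

Lemma mem_power_edge (e : {e | e \in edges G}) (z : vert P) :
  (z \in power_edge m e) =
  match z with inl a => a \in val e | inr p => p.1 == e end.
Proof.
rewrite !inE; case: z => [a|[e' j]] /=.
  rewrite mem_imset; last by move=> ? ? [].
  rewrite [X in _ || X](_ : _ = false) ?orbF //.
  by apply/imsetP => -[].
rewrite [X in X || _](_ : _ = false) /=; last by apply/imsetP => -[].
by apply/imsetP/eqP => [[j' _ [-> //]]|->]; exists j.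
Qed.

Lemma common_power_edge (z w : vert P) :
  in_common_edge z w = [exists e : {e | e \in edges G},
    (z \in power_edge m e) && (w \in power_edge m e)].
Proof.
apply/existsP/existsP => [[e /andP[/imsetP[e' _ ->]]]|[e zwe]].
  by exists e'.
by exists (power_edge m e); rewrite imset_f.
Qed.

Lemma common_power_edge_ll (a b : vert G) :
  (inl b != inl a :> vert P) && in_common_edge (inl b : vert P) (inl a) = gadj a b.
Proof.
rewrite common_power_edge (_ : (_ != _) = (b != a)) //.
apply/andP/idP => [[b_neq /existsP[e]]|ab].
  rewrite !mem_power_edge => /andP[be ae].
  have [c c_neq ec] := card2_setP (E2 (valP e)) ae.
  move: be; rewrite ec !inE (negPf b_neq) /= => /eqP->.
  by rewrite /gadj -ec (valP e).
rewrite eq_sym (edge_neq E2 ab); split=> //; apply/existsP.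
by exists (exist _ [set a; b] ab); rewrite !mem_power_edge set21 set22.
Qed.

Lemma common_power_edge_lr (a : vert G) e j :
  in_common_edge (inr (e, j) : vert P) (inl a) = (a \in val e).
Proof.
rewrite common_power_edge; apply/existsP/idP => [[e']|ae].
  by rewrite !mem_power_edge => /andP[/eqP <-].
by exists e; rewrite !mem_power_edge eqxx.
Qed.

Lemma common_power_edge_rr e j e' j' :
  in_common_edge (inr (e, j) : vert P) (inr (e', j')) = (e == e').
Proof.
rewrite common_power_edge; apply/existsP/eqP => [[e'']|->].
  by rewrite !mem_power_edge /= => /andP[/eqP -> /eqP ->].
by exists e'; rewrite !mem_power_edge eqxx.
Qed.

Lemma adj_sum_power_old (y : vert P -> R) a :
  adj_sum y (inl a) = \sum_(b | gadj a b) y (inl b) +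
    \sum_(e : {e | e \in edges G} | a \in val e) \sum_j y (inr (e, j)).
Proof.
rewrite /adj_sum big_sumType /=; congr (_ + _).
  by apply: eq_bigl => b; rewrite common_power_edge_ll.
rewrite pair_big_dep /=; apply: eq_big => [[e j]|[e j] _] //=.
by rewrite common_power_edge_lr andbT.
Qed.

Lemma adj_sum_power_new (y : vert P -> R) e j :
  adj_sum y (inr (e, j)) + y (inr (e, j)) =
  \sum_(a in val e) y (inl a) + \sum_j y (inr (e, j)).
Proof.
rewrite /adj_sum big_sumType /= -addrA; congr (_ + _).
  by apply: eq_bigl => a; rewrite in_common_edge_sym common_power_edge_lr.
rewrite [RHS](bigD1 j) //= addrC; congr (_ + _).
rewrite (reindex_onto (fun j => (e, j)) snd) /=.
  apply: eq_bigl => i; rewrite common_power_edge_rr !eqxx !andbT.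
  by congr (~~ _); apply/eqP/eqP => [[->]|->].
move=> [e' i] /=; rewrite common_power_edge_rr => /andP[_ /eqP ->] //.
Qed.

(* Eliminating the new vertices: each edge [e] with ends [a], [b] carries total
   weight [(m - 2) (x a + x b) / (t + 1)] on its [m - 2] new vertices. *)
Lemma power_eigenvector (t : R) (y : vert P -> R) : 0 < t ->
  (forall z, 0 <= y z) -> (exists z, 0 < y z) ->
  (forall z, adj_sum y z = (t + (m - 2)%:R) * y z) ->
  let eps := (m - 2)%:R / (t + (m - 2)%:R + 1) in
  exists x : vert G -> R,
    [/\ forall a, 0 <= x a, exists a, 0 < x a &
        forall a, t * x a = \sum_(b | gadj a b) x b +
          eps * (#|[set b | gadj a b]|%:R - 1) * x a].
Proof.
move=> t_gt0 y_ge0 [z0 z0_gt0] y_eig eps.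
pose n : R := (m - 2)%:R; have n_ge0 : 0 <= n by rewrite ler0n.
pose x a := y (inl a); exists x.
pose s (e : {e | e \in edges G}) := \sum_j y (inr (e, j)).
have new e : (t + 1) * s e = n * \sum_(a in val e) x a.
  have eq_j j : (t + n + 1) * y (inr (e, j)) = \sum_(a in val e) x a + s e.
    by rewrite -(adj_sum_power_new y e j) y_eig mulrDl mul1r.
  have : (t + n + 1) * s e = n * (\sum_(a in val e) x a + s e).
    rewrite /s mulr_sumr (eq_bigr (fun=> \sum_(a in val e) x a + s e)).
      by rewrite sumr_const card_ord -mulr_natl.
    by move=> j _; apply: eq_j.
  lra.
split=> [a||a]; first exact: y_ge0.
  case: z0 z0_gt0 => [a a_gt0|[e j] ej_gt0]; first by exists a.
  have [/existsP//|/existsPn x_le0] := boolP [exists a, 0 < x a].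
  (* If [x] vanished on all old vertices, [new] would give every edge total weight 0, contradicting
     the positive entry at [(e, j)]. *)
  suff : s e = 0.
    move/eqP; rewrite psumr_eq0 // => /allP/(_ j (mem_index_enum _)) /eqP /=.
    by move=> ej0; move: ej_gt0; rewrite ej0 ltxx.
  have x0 : \sum_(a in val e) x a = 0.
    apply: big1 => a _; apply/eqP; rewrite eq_le y_ge0 andbT.
    by rewrite leNgt x_le0.
  have := new e; rewrite x0 mulr0 => /eqP; rewrite mulf_eq0.
  by case/orP => [/eqP|/eqP//]; lra.
have := y_eig (inl a); rewrite adj_sum_power_old -/n -[y (inl a)]/(x a).
have -> : \sum_(b | gadj a b) y (inl b) = \sum_(b | gadj a b) x b by [].
set X := \sum_(b | gadj a b) x b; set d := #|_|%:R.
(* Each edge [{a, b}] at [a] contributes [x b + x a], hence the term [d * x a]. *)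
have : (t + 1) * (\sum_(e : {e | e \in edges G} | a \in val e) s e) =
       n * (X + d * x a).
  rewrite mulr_sumr; under eq_bigr do rewrite new.
  rewrite -mulr_sumr; congr (n * _).
  rewrite -(big_sub_cond (mem (edges G)) (fun e : {set _} => a \in e)
    (fun e : {set _} => \sum_(b in e) x b)) /=.
  rewrite (sum_incident E2 a (fun e : {set _} => \sum_(b in e) x b)).
  rewrite (eq_bigr (fun b => x b + x a)); last first.
    move=> b /(edge_neq E2) a_neq; rewrite big_setU1 ?inE // big_set1.
    exact: addrC.
  rewrite big_split /= sumr_const; congr (_ + _).
  rewrite -mulr_natl /d; congr (_%:R * _).
  by apply: eq_card => b; rewrite inE.
set S := \sum_(e | _) s e => eqS eq_a.
have tn_gt0 : 0 < t + n + 1 by lra.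
(* The factor [t + 1] eliminates [S]; since [(t + 1)(t + n) = t (t + n + 1) + n], dividing by
   [t + n + 1] leaves the coefficient [eps]. *)
have : (t + 1) * (X + S) = (t + 1) * ((t + n) * x a) by rewrite eq_a.
rewrite mulrDr eqS /eps -/n => {}eqS.
apply: (mulfI (lt0r_neq0 tn_gt0)).
transitivity ((t + n + 1) * X + n * (d - 1) * x a); first by nra.
by field; rewrite lt0r_neq0.
Qed.

End PowerSpectrum.

(** * A lower bound for the spectral radius of [T2C] *)

Definition T2C_adj : rel 'I_7 := fun i i' =>
  (i' : nat) \in nth [::]
    [:: [:: 1; 2; 3; 4; 5; 6]; [:: 0; 2]; [:: 0; 1]; [:: 0; 4]; [:: 0; 3];
        [:: 0; 6]; [:: 0; 5]]%N i.

Lemma T2C_adjP (i i' : 'I_7) : T2C_adj i i' ->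
  (i' != i) && [exists j, (i' \in T2C_ends j) && (i \in T2C_ends j)].
Proof.
pose edge_no (i i' : nat) := find (fun s => (i \in s) && (i' \in s))
  [:: [:: 0; 1]; [:: 1; 2]; [:: 2; 0]; [:: 0; 3]; [:: 3; 4]; [:: 4; 0];
      [:: 0; 5]; [:: 5; 6]; [:: 6; 0]]%N.
suff P : T2C_adj i i' -> [&& i' != i, (edge_no i i' < 9)%N,
    i' \in T2C_ends (inord (edge_no i i')) &
    i \in T2C_ends (inord (edge_no i i'))].
  case/P/and4P => -> _ e' e; apply/existsP.
  by exists (inord (edge_no i i')); rewrite e' e.
rewrite /T2C_adj !inE.
by case: i => -[|[|[|[|[|[|[|//]]]]]]] ?; case: i' => -[|[|[|[|[|[|[|//]]]]]]] ?;
  rewrite //= => _; rewrite /edge_no /= inordK.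
Qed.

(** Only lower bounds for [adj_sum] on [T2C] are required. With nonnegative weights it suffices to
    exhibit neighbours, without determining the whole neighbourhood. *)
Lemma ler_sum_subpred (R : numDomainType) (I : finType) (P Q : pred I) (F : I -> R) :
  (forall i, 0 <= F i) -> subpred P Q -> \sum_(i | P i) F i <= \sum_(i | Q i) F i.
Proof.
move=> F_ge0 PQ; rewrite big_mkcond [leRHS]big_mkcond ler_sum // => i _.
by case: ifP => [/PQ ->|_]; last case: ifP.
Qed.

Lemma ler_sum_pair (R : numDomainType) (I J : finType) (A : pred I) (B : pred J)
    (Q : pred (I * J)) (F : I * J -> R) (G : I -> R) :
  (forall p, 0 <= F p) -> (forall i j, A i -> B j -> Q (i, j)) ->
  (forall i j, F (i, j) = G i) ->
  \sum_(i | A i) #|B|%:R * G i <= \sum_(p | Q p) F p.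
Proof.
move=> F_ge0 ABQ FG.
apply: le_trans (ler_sum_subpred F_ge0 (_ : subpred
  (fun p => A p.1 && B p.2) _)); last by move=> [i j] /andP[]; apply: ABQ.
rewrite (eq_bigr (fun p => F (p.1, p.2))); last by case.
rewrite -(pair_big A B (fun i j => F (i, j))) /= ler_sum // => i _.
by rewrite (eq_bigr (fun=> G i)) // sumr_const mulr_natl.
Qed.

Section T2CVector.
Variables (R : realFieldType) (m : nat) (l : seq nat) (t : R) (x : 'I_7 -> R).
Hypotheses (m_ge2 : (2 <= m)%N) (t_gt0 : 0 < t) (x_ge0 : forall i, 0 <= x i).
Let n : R := (m - 2)%:R.
Let H := T2C m l.

(* A solution of the eigenvalue equation at all vertices but the [v_i]. *)
Definition T2C_vector (z : vert H) : R :=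
  match z with
  | inl (inl i) => x i
  | inl (inr (j, _)) => (\sum_(i in T2C_ends j) x i) / (t + 1)
  | inr (p, _) => x (tag p) / t
  end.
Let y := T2C_vector.

Let n_ge0 : 0 <= n. Proof. exact: ler0n. Qed.
Let t1_gt0 : 0 < t + 1. Proof. by rewrite ltr_wpDl // ltW. Qed.

Lemma T2C_vector_ge0 z : 0 <= y z.
Proof.
by case: z => [[i|[j u]]|[p u]] //=; rewrite divr_ge0 ?sumr_ge0 // ltW.
Qed.

Let common_cycle (z w : vert H) j :
  z \in T2C_cycle_edge m l j -> w \in T2C_cycle_edge m l j -> in_common_edge z w.
Proof.
move=> zj wj; apply/existsP; exists (T2C_cycle_edge m l j).
by rewrite zj wj !andbT /= inE imset_f.
Qed.

Let common_pendant (z w : vert H) (p : T2C_pendant l) :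
  z \in T2C_pendant_edge m p -> w \in T2C_pendant_edge m p -> in_common_edge z w.
Proof.
move=> zj wj; apply/existsP; exists (T2C_pendant_edge m p).
by rewrite zj wj !andbT /= inE imset_f ?orbT.
Qed.

Let mem_cycle_core i j : i \in T2C_ends j ->
  inl (inl i) \in T2C_cycle_edge m l j.
Proof. by move=> ij; rewrite inE imset_f. Qed.

Let mem_cycle_new j u : inl (inr (j, u)) \in T2C_cycle_edge m l j.
Proof. by rewrite inE imset_f ?orbT. Qed.

Let mem_pendant_new (p : T2C_pendant l) u : inr (p, u) \in T2C_pendant_edge m p.
Proof. by rewrite !inE imset_f ?orbT. Qed.

Let mem_pendant_core (p : T2C_pendant l) :
  inl (inl (tag p)) \in T2C_pendant_edge m p.
Proof. by rewrite !inE eqxx. Qed.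

Lemma T2C_vector_new j u :
  (t + n) * y (inl (inr (j, u))) <= adj_sum y (inl (inr (j, u))).
Proof.
pose Y := (\sum_(i in T2C_ends j) x i) / (t + 1).
have Y_ge0 : 0 <= Y by rewrite divr_ge0 ?sumr_ge0 // ltW.
rewrite /adj_sum !big_sumType /= -/Y.
apply: (@le_trans _ _ (\sum_(i in T2C_ends j) x i + (n - 1) * Y)).
  have : \sum_(i in T2C_ends j) x i = (t + 1) * Y.
    by rewrite /Y mulrC divfK // lt0r_neq0.
  by move=> ->; rewrite le_eqVlt; apply/orP; left; apply/eqP; ring.
rewrite -[leLHS]addr0 !lerD //.
- apply: ler_sum_subpred => // i ij.
  by apply: common_cycle (mem_cycle_core ij) (mem_cycle_new j u).
- apply: (@le_trans _ _ (\sum_(j' | j' == j) #|predC1 u|%:R *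
      ((\sum_(i in T2C_ends j') x i) / (t + 1)))).
    rewrite big_pred1_eq cardC1 card_ord -/Y ler_wpM2r // /n.
    (* The element [u] shows that [m - 2] is positive, so the truncated predecessor really is
       [n - 1]. *)
    by case: (m - 2)%N u => [[]//|q u]; rewrite -natr1 addrK.
  apply: ler_sum_pair => // [p|_ u' /eqP -> u'_neq].
    exact: (T2C_vector_ge0 (inl (inr p))).
  apply/andP; split; first by apply: contra u'_neq => /eqP[->].
  by apply: common_cycle (mem_cycle_new _ _) (mem_cycle_new _ _).
- by apply: sumr_ge0 => p _; apply: (T2C_vector_ge0 (inr p)).
Qed.

Lemma T2C_vector_pendant p u :
  (t + n) * y (inr (p, u)) <= adj_sum y (inr (p, u)).
Proof.
pose Y := x (tag p) / t; have Y_ge0 : 0 <= Y by rewrite divr_ge0 // ltW.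
rewrite /adj_sum !big_sumType /= -/Y.
apply: (@le_trans _ _ (x (tag p) + 0 + n * Y)).
  rewrite addr0 mulrDl lerD2r /Y mulrC divfK // lt0r_neq0 //.
rewrite !lerD //.
- rewrite -[leLHS](big_pred1_eq +%R); apply: ler_sum_subpred => // i /= /eqP->.
  by apply: common_pendant (mem_pendant_core p) (mem_pendant_new p u).
- by apply: sumr_ge0 => p' _; apply: (T2C_vector_ge0 (inl (inr p'))).
- apply: (@le_trans _ _ (\sum_(p' | p' == p) #|predC1 u|%:R * (x (tag p') / t))).
    rewrite big_pred1_eq cardC1 card_ord -/Y ler_wpM2r // /n ler_nat; lia.
  apply: ler_sum_pair => // [q|_ u' /eqP -> u'_neq].
    exact: (T2C_vector_ge0 (inr q)).
  apply/andP; split; first by apply: contra u'_neq => /eqP[->].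
  by apply: common_pendant (mem_pendant_new _ _) (mem_pendant_new _ _).
Qed.

Lemma T2C_vector_core i :
  \sum_(i' | T2C_adj i i') x i' +
  (\sum_(j | i \in T2C_ends j) \sum_(i' in T2C_ends j) x i') * n / (t + 1) +
  (nth 0%N l i)%:R * (n + 1) * x i / t <= adj_sum y (inl (inl i)).
Proof.
rewrite /adj_sum !big_sumType /= !lerD //.
- apply: ler_sum_subpred => // i' /T2C_adjP/andP[i'_neq /existsP[j /andP[i'j ij]]].
  apply/andP; split; first by apply: contra i'_neq => /eqP[->].
  by apply: common_cycle (mem_cycle_core i'j) (mem_cycle_core ij).
- apply: (@le_trans _ _ (\sum_(j | i \in T2C_ends j) #|predT : pred 'I_(m - 2)|%:R *
      ((\sum_(i' in T2C_ends j) x i') / (t + 1)))).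
    rewrite -mulrA mulr_suml le_eqVlt; apply/orP; left; apply/eqP.
    by apply: eq_bigr => j _; rewrite card_ord mulrCA.
  apply: ler_sum_pair => // [p|j u ij _]; first exact: (T2C_vector_ge0 (inl (inr p))).
  by apply: common_cycle (mem_cycle_new j u) (mem_cycle_core ij).
- apply: (@le_trans _ _ (\sum_(p : T2C_pendant l | tag p == i)
      #|predT : pred 'I_(m - 1)|%:R * (x (tag p) / t))); last first.
    apply: ler_sum_pair => // [p|p u /eqP <- _]; first exact: (T2C_vector_ge0 (inr p)).
    by apply: common_pendant (mem_pendant_new _ _) (mem_pendant_core _).
  rewrite (eq_bigr (fun=> (n + 1) * x i / t)); last first.
    move=> p /eqP <-; rewrite card_ord mulrA /n natr1.
    by rewrite (_ : (m - 2).+1 = (m - 1)%N) //; lia.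
  rewrite sumr_const -[leRHS]mulr_natl !mulrA.
  rewrite (_ : #|_| = nth 0%N l i) //.
  rewrite -[RHS](card_ord (nth 0%N l i)).
  pose pend (u : 'I_(nth 0%N l i)) : T2C_pendant l := Tagged _ u.
  have pend_inj : injective pend.
    by move=> u u' /eqP; rewrite /pend eq_Tagged => /eqP.
  rewrite -(card_imset _ pend_inj).
  apply: eq_card => p; rewrite -topredE /=; apply/eqP/imsetP => [|[u _ ->]//].
  by case: p => i' u /= ii'; have {}ii' : i' = i := val_inj ii'; subst i'; exists u.
Qed.

End T2CVector.

Section T2CSums.
Variables (R : nmodType) (X : nat -> R).

Lemma T2C_sum_adj (i : 'I_7) : \sum_(i' | T2C_adj i i') X i' =
  nth 0 [:: X 1%N + X 2%N + X 3%N + X 4%N + X 5%N + X 6%N; X 0%N + X 2%N; X 0%N + X 1%N;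
            X 0%N + X 4%N; X 0%N + X 3%N; X 0%N + X 6%N; X 0%N + X 5%N] i.
Proof.
rewrite /T2C_adj big_mkcond !big_ord_recr big_ord0 /=.
by case: i => -[|[|[|[|[|[|[|//]]]]]]] ? /=; rewrite ?addr0 ?add0r.
Qed.

Lemma T2C_sum_ends (j : 'I_9) : \sum_(i in T2C_ends j) X i =
  nth 0 [:: X 0%N + X 1%N; X 1%N + X 2%N; X 0%N + X 2%N;
            X 0%N + X 3%N; X 3%N + X 4%N; X 0%N + X 4%N;
            X 0%N + X 5%N; X 5%N + X 6%N; X 0%N + X 6%N] j.
Proof.
rewrite big_mkcond !big_ord_recr big_ord0 /= !inE.
by case: j => -[|[|[|[|[|[|[|[|[|//]]]]]]]]] ? /=; rewrite ?addr0 ?add0r.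
Qed.

Lemma T2C_sum_cycle_edges (i : 'I_7) :
  \sum_(j | i \in T2C_ends j) \sum_(i' in T2C_ends j) X i' =
  nth 0 [:: X 1%N + X 2%N + X 3%N + X 4%N + X 5%N + X 6%N + X 0%N *+ 6; X 0%N + X 2%N + X 1%N *+ 2;
    X 0%N + X 1%N + X 2%N *+ 2; X 0%N + X 4%N + X 3%N *+ 2; X 0%N + X 3%N + X 4%N *+ 2;
    X 0%N + X 6%N + X 5%N *+ 2; X 0%N + X 5%N + X 6%N *+ 2] i.
Proof.
under eq_bigr do rewrite T2C_sum_ends.
rewrite big_mkcond !big_ord_recr big_ord0 /= !inE.
case: i => -[|[|[|[|[|[|[|//]]]]]]] ? /=; rewrite ?addr0 ?add0r ?mulr2n.
- rewrite !mulrS mulr0n addr0.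
  by rewrite (AC (2*2*2*2*2*2) ((2*4*6*8*10*12)*(1*(3*(5*(7*(9*11))))))).
- by rewrite (AC (2*2) (1*4*(2*3))).
- by rewrite (AC (2*2) (3*1*(2*4))).
- by rewrite (AC (2*2) (1*4*(2*3))).
- by rewrite (AC (2*2) (3*1*(2*4))).
- by rewrite (AC (2*2) (1*4*(2*3))).
- by rewrite (AC (2*2) (3*1*(2*4))).
Qed.

End T2CSums.

(** The test vector has weight 1 at [v_1], [c + dl] at [v_2], and [c] at the other triangle
    vertices; [dl] is the surplus due to the pendant edge at [v_2]. The last three hypotheses are
    the reduced inequalities at [v_3, ..., v_7], at [v_2] and at [v_1], with a leaf next to a weight
    [X] already replaced by [X / t]. Strictness is asked at [v_1] alone. *)
Lemma T2C_lambda1_gt (C : numClosedFieldType) (m q : nat) (s t c dl : realC C) :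
  let n : realC C := (m - 2)%:R in
  let eps := n / (t + n + 1) in
  (2 <= m)%N -> 0 < t -> 0 <= c -> 0 <= dl -> (m - 1)%:R * s = t + n ->
  (t - eps) * c <= 1 + c ->
  (t - 2%:R * eps - t^-1) * (c + dl) <= 1 + c ->
  t - eps * (q%:R + 5%:R) < q%:R / t + 6%:R * c + dl ->
  val s < lambda1 C m (T2C m [:: q; 1]%N).
Proof.
move=> n eps m_ge2 t_gt0 c_ge0 dl_ge0 st le_c le_cdl lt_v1.
have n_ge0 : 0 <= n by rewrite ler0n.
have s_ge0 : 0 <= s.
  have : 0 <= (m - 1)%:R * s by rewrite st; lra.
  by rewrite pmulr_rge0 // ltr0n; lia.
pose x (i : 'I_7) := nth c [:: 1; c + dl] i.
have x_ge0 i : 0 <= x i.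
  by rewrite /x; case: i => -[|[|[|[|[|[|[|//]]]]]]] ? //=; rewrite addr_ge0.
have t1_gt0 : 0 < t + 1 by lra.
have tn_gt0 : 0 < t + n + 1 by lra.
have core i : (t + n) * x i <= adj_sum (@T2C_vector _ m [:: q; 1]%N t x) (inl (inl i))
    /\ (i = ord0 ->
        (t + n) * x i < adj_sum (@T2C_vector _ m [:: q; 1]%N t x) (inl (inl i))).
  have := @T2C_vector_core _ m [:: q; 1]%N t x m_ge2 t_gt0 x_ge0 i.
  rewrite (T2C_sum_adj (nth c [:: 1; c + dl])).
  rewrite (T2C_sum_cycle_edges (nth c [:: 1; c + dl])) -/n.
  set S := adj_sum _ _.
  have K_gt0 : 0 < (t + n + 1) / (t + 1) by rewrite divr_gt0.
  (* The positive factor [(t + n + 1) / (t + 1)] undoes the elimination of the new vertices and is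
     common to both sides. In [scale_rhs], [g] and [l] count the cycle edges and the pendant edges
     at the vertex. *)
  have scale_lhs X : (t + n) * X = (t + n + 1) / (t + 1) * (t * X + eps * X).
    by rewrite /eps; field; rewrite !lt0r_neq0.
  have scale_rhs A X (g l : nat) : A + (A + X *+ g) * n / (t + 1) +
      l%:R * (n + 1) * X / t =
      (t + n + 1) / (t + 1) * (A + (g + l)%:R * eps * X + l%:R * X / t).
    by rewrite natrD -mulr_natl /eps; field; rewrite !lt0r_neq0.
  case: i S => -[|[|[|[|[|[|[|//]]]]]]] i_lt S; rewrite /x /=; rewrite scale_rhs => S_ge.
  - suff lt_S : (t + n) * 1 < S by split; [apply: ltW | ].
    apply: lt_le_trans S_ge; rewrite scale_lhs ltr_pM2l // natrD; lra.
  - split; last by move/(congr1 val).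
    apply: le_trans S_ge; rewrite scale_lhs ler_pM2l //; lra.
  - split; last by move/(congr1 val).
    apply: le_trans S_ge; rewrite scale_lhs ler_pM2l //; lra.
  - split; last by move/(congr1 val).
    apply: le_trans S_ge; rewrite scale_lhs ler_pM2l //; lra.
  - split; last by move/(congr1 val).
    apply: le_trans S_ge; rewrite scale_lhs ler_pM2l //; lra.
  - split; last by move/(congr1 val).
    apply: le_trans S_ge; rewrite scale_lhs ler_pM2l //; lra.
  - split; last by move/(congr1 val).
    apply: le_trans S_ge; rewrite scale_lhs ler_pM2l //; lra.
apply: (@lambda1_gt _ _ _ m_ge2 (@T2C_vector _ m [:: q; 1]%N t x)) => //.
- by move=> z; apply: T2C_vector_ge0.
- case=> [[i|[j u]]|[p u]]; rewrite st; first by have [] := core i.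
    exact: T2C_vector_new.
  exact: T2C_vector_pendant.
- by exists (inl (inl ord0)); rewrite st; have [_ ->] := core ord0.
Qed.

(** * Cycles of a graph and loose cycles of its power hypergraph *)

(** The definition indexes a cycle by ['I_#|c|]. Injectivity of [e] yields [#|c| = l], which permits
    a presentation over any ['I_l]. *)
Lemma loose_cycleI (V : finType) (c : {set {set V}}) (l : nat)
    (v : 'I_l -> V) (e : 'I_l -> {set V}) :
  (2 < l)%N -> injective e -> injective v -> c = [set e i | i : 'I_l] ->
  (forall i, e (ord_pred i) :&: e i = [set v i]) ->
  (forall i j, [|| j == i, j == ordS i, i == ordS j | [disjoint e i & e j]]) ->
  loose_cycle c.
Proof.
move=> l_gt2 e_inj v_inj cE ev e_disj.
have cl : #|c| = l by rewrite cE card_imset // card_ord.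
move: v e l_gt2 e_inj v_inj cE ev e_disj; rewrite -cl => v e l_gt2 e_inj v_inj cE ev e_disj.
rewrite /loose_cycle l_gt2; apply/existsP; exists (finfun v).
apply/existsP; exists (finfun e); apply/and4P; split.
- by rewrite {1}cE; apply/eqP; apply: eq_imset => i; rewrite ffunE.
- by apply/injectiveP => i j; rewrite !ffunE => /v_inj.
- by apply/forallP => i; rewrite !ffunE ev.
- by apply/forallP => i; apply/forallP => j; rewrite !ffunE.
Qed.

Lemma ordS_neq l (i : 'I_l) : (1 < l)%N -> ordS i != i.
Proof.
move=> l_gt1; rewrite -val_eqE /=; have := ltn_ord i.
rewrite leq_eqVlt => /predU1P[Si|Si_lt]; first by rewrite Si modnn; lia.
by rewrite modn_small // gtn_eqF.
Qed.

Lemma ordSS_neq l (i : 'I_l) : (2 < l)%N -> ordS (ordS i) != i.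
Proof.
move=> l_gt2; rewrite -val_eqE /=; have := ltn_ord i.
rewrite leq_eqVlt => /predU1P[Si|Si_lt]; first by rewrite Si modnn modn_small; lia.
rewrite (modn_small Si_lt); move: Si_lt.
rewrite leq_eqVlt => /predU1P[SSi|SSi_lt]; first by rewrite SSi modnn; lia.
by rewrite modn_small //; lia.
Qed.

(** A cycle is its edge set, so that changing the starting point or the direction does not count
    twice. *)
Definition gcycle (G : hypergraph) (c : {set {set vert G}}) : Prop :=
  exists l (a : 'I_l -> vert G),
    [/\ (2 < l)%N, injective a, forall i, gadj (a i) (a (ordS i))
      & c = [set [set a i; a (ordS i)] | i : 'I_l]].

Section PowerCycles.
Variables (m : nat) (G H : hypergraph).
Let P := power_hypergraph m G.
Variable g : vert P -> vert H.
Hypotheses (g_bij : bijective g)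
  (gE : [set g @: (e : {set vert P}) | e in edges P] = edges H).
Let g_inj := bij_inj g_bij.

(** The image of [power_edge], extended to arbitrary vertex sets so that it is injective everywhere
    and acts on sets of edges by plain image. *)
Let lift_edge (e : {set vert G}) : {set vert H} :=
  g @: [set z : vert P | match z with inl a => a \in e | inr p => val p.1 == e end].

Let mem_lift_edge e a : (g (inl a) \in lift_edge e) = (a \in e).
Proof. by rewrite mem_imset // inE. Qed.

Let lift_edge_inj : injective lift_edge.
Proof. by move=> e f ef; apply/setP => a; rewrite -!mem_lift_edge ef. Qed.

Let lift_edgeI e f : e != f -> lift_edge e :&: lift_edge f = [set g (inl a) | a in e :&: f].
Proof.
move=> ef; apply/setP => w; rewrite inE; apply/andP/imsetP => [[]|[a]].
  case/imsetP => z; rewrite inE => ze ->.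
  rewrite mem_imset // inE; case: z ze => [a ae af|p /eqP pe /eqP pf].
    by exists a; rewrite // inE ae.
  by rewrite -pe -pf eqxx in ef.
by rewrite inE => /andP[ae af] ->; rewrite !mem_lift_edge.
Qed.

Let lift_edge_in e : e \in edges G -> lift_edge e \in edges H.
Proof.
move=> eG; rewrite -gE; apply/imsetP.
exists (power_edge m (exist _ e eG)); first exact: imset_f.
apply/setP => w; apply/imsetP/imsetP => -[z ze ->]; exists z => //; move: ze.
  by rewrite mem_power_edge inE; case: z.
by rewrite mem_power_edge inE; case: z.
Qed.

Let lift_gcycle c : gcycle c ->
  (lift_edge @: c \subset edges H) && loose_cycle (lift_edge @: c).
Proof.
move=> [l [a [l_gt2 a_inj a_adj cE]]]; apply/andP; split.
  apply/subsetP => f /imsetP[e]; rewrite {1}cE => /imsetP[i _ ->] ->.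
  exact: lift_edge_in (a_adj i).
have l_gt1 := ltnW l_gt2.
pose ed i := [set a i; a (ordS i)].
(* Here the length must exceed 2: two vertices would give the same edge twice. *)
have ed_inj : injective ed.
  move=> i j ij; have : a i \in ed j by rewrite -ij set21.
  rewrite !inE => /orP[/eqP/a_inj//|/eqP/a_inj iSj].
  have : a (ordS i) \in ed j by rewrite -ij set22.
  rewrite !inE iSj => /orP[]/eqP/a_inj/eqP.
    by rewrite (negPf (ordSS_neq j l_gt2)).
  by rewrite (negPf (ordS_neq _ l_gt1)).
apply: (@loose_cycleI _ _ l (fun i => g (inl (a i))) (fun i => lift_edge (ed i))) => //.
- by move=> i j /lift_edge_inj/ed_inj.
- by move=> i j /g_inj[/a_inj].
- by rewrite cE -imset_comp.
- move=> i; have pi_neq : ord_pred i != i.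
    by rewrite -{2}(ord_predK i) eq_sym ordS_neq.
  rewrite lift_edgeI ?(inj_eq ed_inj) //.
  rewrite (_ : ed _ :&: ed _ = [set a i]) ?imset_set1 //.
  apply/setP => b; rewrite !inE ord_predK; apply/idP/eqP => [|->]; last first.
    by rewrite eqxx orbT.
  case/andP => /orP[/eqP->|/eqP-> //]; rewrite !(inj_eq a_inj) (negPf pi_neq) /=.
  by rewrite -[X in _ == ordS X](ord_predK i) eq_sym (negPf (ordSS_neq _ l_gt2)).
- move=> i j; case: eqVneq => //= ji; case: eqVneq => //= jSi.
  case: eqVneq => //= iSj.
  have ed_neq : ed i != ed j by rewrite (inj_eq ed_inj) eq_sym.
  rewrite -setI_eq0 lift_edgeI //.
  rewrite imset_eq0 -subset0; apply/subsetP => b; rewrite !inE.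
  case/andP => /orP[]/eqP->; rewrite !(inj_eq a_inj) ?(inj_eq (@ordS_inj _)).
    by rewrite eq_sym (negPf ji) (negPf iSj).
  by rewrite eq_sym (negPf jSi) eq_sym (negPf ji).
Qed.

(** Different cycles of [G] lift to different loose cycles of [H]. This is the form in which the
    number of cycles enters the arguments on [G]. *)
Lemma gcycles_le3 (X : {set {set {set vert G}}}) : three_cyclic H ->
  (forall c, c \in X -> gcycle c) -> (#|X| <= 3)%N.
Proof.
move=> /eqP <- X_cycles.
rewrite -(card_imset _ (imset_inj lift_edge_inj)) subset_leq_card //.
apply/subsetP => _ /imsetP[c cX ->]; rewrite inE.
exact/lift_gcycle/X_cycles.
Qed.

End PowerCycles.

(** * Recognizing [T2C] as a power hypergraph *)

Lemma T2C_ends_inj : injective T2C_ends.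
Proof.
move=> j j' ends_jj'.
(* Weighting vertex [i] by [2 ^ i] encodes a set of ends as an integer; the nine values are
   distinct. *)
have := T2C_sum_ends (fun i => (2 ^ i)%N) j; rewrite ends_jj' T2C_sum_ends.
case: j {ends_jj'} => -[|[|[|[|[|[|[|[|[|//]]]]]]]]] lt_j;
  case: j' => -[|[|[|[|[|[|[|[|[|//]]]]]]]]] lt_j' //= _; exact: val_inj.
Qed.

Lemma mem_T2C_cycle_edge m l j (z : T2C_vert m l) :
  (z \in T2C_cycle_edge m l j) =
  match z with
  | inl (inl i) => i \in T2C_ends j
  | inl (inr (j', _)) => j' == j
  | inr _ => false
  end.
Proof.
rewrite in_setU; case: z => [[i|[j' u]]|q].
- rewrite mem_imset; last by move=> ? ? [].
  by rewrite [X in _ || X](_ : _ = false) ?orbF //; apply/imsetP => -[].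
- rewrite [X in X || _](_ : _ = false) /=; last by apply/imsetP => -[].
  by apply/imsetP/eqP => [[u' _ [-> //]]|->]; exists u.
- by apply/orP => -[] /imsetP[].
Qed.

Lemma mem_T2C_pendant_edge m l (p : T2C_pendant l) (z : T2C_vert m l) :
  (z \in T2C_pendant_edge m p) =
  match z with
  | inl (inl i) => i == tag p
  | inl (inr _) => false
  | inr q => q.1 == p
  end.
Proof.
rewrite in_setU1; case: z => [[i|q]|[p' u]].
- rewrite [X in _ || X](_ : _ = false) ?orbF; last by apply/imsetP => -[].
  by apply/eqP/eqP => [[->]|->].
- by apply/orP => -[/eqP //|/imsetP[]].
- by apply/imsetP/eqP => [[u' _ [-> //]]|/= ->]; exists u.
Qed.

Section T2CPower.
Variables (m : nat) (G : hypergraph) (l : seq nat).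
Variables (core : 'I_7 -> vert G) (pend : T2C_pendant l -> vert G).
Hypotheses (m_ge2 : (2 <= m)%N) (G2 : uniform 2 G).
Hypotheses (core_inj : injective core) (pend_inj : injective pend)
  (core_pend : forall i p, core i != pend p)
  (cycle_in : forall j, core @: T2C_ends j \in edges G)
  (pend_in : forall p, [set core (tag p); pend p] \in edges G)
  (card_vert : #|vert G| = (7 + #|T2C_pendant l|)%N)
  (card_edges : #|edges G| = (9 + #|T2C_pendant l|)%N).

Let edge_of (s : 'I_9 + T2C_pendant l) : {e | e \in edges G} :=
  match s with
  | inl j => exist (fun e => e \in edges G) _ (cycle_in j)
  | inr p => exist (fun e => e \in edges G) _ (pend_in p)
  end.

Let pend_notin p j : pend p \notin core @: T2C_ends j.
Proof. by apply/imsetP => -[i _ /esym/eqP]; rewrite (negPf (core_pend _ _)). Qed.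

Let edge_of_inj : injective edge_of.
Proof.
move=> [j|p] [j'|p'] /(congr1 val) /= eq_e.
- by congr inl; apply/T2C_ends_inj/(imset_inj core_inj).
- by have := pend_notin p' j; rewrite eq_e set22.
- by have := pend_notin p j'; rewrite -eq_e set22.
- congr inr; apply: pend_inj; have : pend p \in [set core (tag p'); pend p'].
    by rewrite -eq_e set22.
  by rewrite !inE eq_sym (negPf (core_pend _ _)) => /eqP.
Qed.

Let edge_of_bij : bijective edge_of.
Proof.
apply: inj_card_bij edge_of_inj _.
by rewrite card_sig card_sum card_ord -card_edges.
Qed.

(* The last of the [m - 1] new vertices of a pendant edge is its graph vertex. *)
Let f (z : T2C_vert m l) : vert (power_hypergraph m G) :=
  match z with
  | inl (inl i) => inl (core i)
  | inl (inr (j, u)) => inr (edge_of (inl j), u)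
  | inr (p, u) =>
      if insub (u : nat) is Some u' then inr (edge_of (inr p), u') else inl (pend p)
  end.

Let f_pend (p : T2C_pendant l) (u : 'I_(m - 1)) :
  (exists2 u' : 'I_(m - 2), u' = u :> nat & f (inr (p, u)) = inr (edge_of (inr p), u')) \/
  (u = (m - 2)%N :> nat /\ f (inr (p, u)) = inl (pend p)).
Proof.
rewrite /f; case: insubP => [u' _ u'E|]; first by left; exists u'.
by rewrite -leqNgt => u_ge; right; split=> //; have := ltn_ord u; lia.
Qed.

Let f_inj : injective f.
Proof.
move=> [[i|[j u]]|[p u]] [[i'|[j' u']]|[p' u']] //.
- by case=> /core_inj->.
- have [[u1 _ ->]|[_ ->]] := f_pend p' u'; first by [].
  by case=> /eqP; rewrite (negPf (core_pend _ _)).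
- by case=> /(imset_inj core_inj)/T2C_ends_inj-> ->.
- have [[u1 _ ->]|[_ ->]] := f_pend p' u'; last by [].
  by case=> e _; have /edge_of_inj : edge_of (inl j) = edge_of (inr p') by exact: val_inj.
- have [[u1 _ ->]|[_ ->]] := f_pend p u; first by [].
  by case=> /esym/eqP; rewrite (negPf (core_pend _ _)).
- have [[u1 _ ->]|[_ ->]] := f_pend p u; last by [].
  by case=> e _; have /edge_of_inj : edge_of (inr p) = edge_of (inl j') by exact: val_inj.
- have [[u1 u1E ->]|[uE ->]] := f_pend p u; have [[u2 u2E ->]|[u'E ->]] := f_pend p' u'; try by [].
  + case=> e u12; have /edge_of_inj[->] : edge_of (inr p) = edge_of (inr p').
      exact: val_inj.
    by congr (inr (_, _)); apply: val_inj; rewrite /= -u1E -u2E u12.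
  + case=> /pend_inj ->; congr (inr (_, _)); apply: val_inj.
    by rewrite /= uE u'E.
Qed.

Let f_bij : bijective f.
Proof.
apply: inj_card_bij f_inj _.
rewrite !card_sum !card_prod card_sig !card_ord card_vert.
rewrite (eq_card (_ : _ =i edges G)) ?card_edges //.
(* With [p] pendant edges, [7 + 9 (m - 2) + p (m - 1) = (7 + p) + (9 + p)(m - 2)]. *)
by rewrite (_ : m - 1 = (m - 2).+1)%N; lia.
Qed.

Let mem_f_cycle z j :
  (f z \in power_edge m (edge_of (inl j))) = (z \in T2C_cycle_edge m l j).
Proof.
rewrite mem_T2C_cycle_edge mem_power_edge; case: z => [[i|[j' u]]|[p u]].
- by rewrite /= mem_imset.
- exact: (inj_eq edge_of_inj (inl j') (inl j)).
- have [[u1 _ ->]|[_ ->]] := f_pend p u; last exact/negbTE/pend_notin.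
  exact: (inj_eq edge_of_inj (inr p) (inl j)).
Qed.

Let mem_f_pendant z p :
  (f z \in power_edge m (edge_of (inr p))) = (z \in T2C_pendant_edge m p).
Proof.
rewrite mem_T2C_pendant_edge mem_power_edge; case: z => [[i|[j' u]]|[p' u]].
- by rewrite /= !inE (inj_eq core_inj) (negPf (core_pend _ _)) orbF.
- exact: (inj_eq edge_of_inj (inl j') (inr p)).
- have [[u1 _ ->]|[_ ->]] := f_pend p' u.
    exact: (inj_eq edge_of_inj (inr p') (inr p)).
  by rewrite /= !inE eq_sym (negPf (core_pend _ _)) (inj_eq pend_inj).
Qed.

(** It is enough to embed the graph of [T2C] into [G]: equality of the vertex and edge counts makes
    the injections [f] and [edge_of] bijective. *)
Lemma hiso_T2C_power : hiso (T2C m l) (power_hypergraph m G).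
Proof.
have [g fK gK] := f_bij; exists f; first by exists g.
have f_cycle j : f @: T2C_cycle_edge m l j = power_edge m (edge_of (inl j)).
  by apply/setP => w; rewrite -(gK w) mem_f_cycle mem_imset.
have f_pendant p : f @: T2C_pendant_edge m p = power_edge m (edge_of (inr p)).
  by apply/setP => w; rewrite -(gK w) mem_f_pendant mem_imset.
apply/setP => e; apply/imsetP/imsetP => [[e']|[e' _ ->]].
  case/setUP => /imsetP[s _ ->] ->; rewrite ?f_cycle ?f_pendant.
    by exists (edge_of (inl s)).
  by exists (edge_of (inr s)).
have [edge_inv _ edge_invK] := edge_of_bij.
rewrite -(edge_invK e'); case: (edge_inv e') => [j|p].
  by exists (T2C_cycle_edge m l j); rewrite ?f_cycle // inE imset_f.
by exists (T2C_pendant_edge m p); rewrite ?f_pendant // inE imset_f ?orbT.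
Qed.

End T2CPower.

(** * Short cycles through a vertex *)

(** Presents an explicit short cycle by its list of vertices; [zip s (rot 1 s)] lists the
    consecutive pairs, including the last with the first. *)
Lemma gcycle_seq (G : hypergraph) (s : seq (vert G)) :
  uniq s -> (2 < size s)%N -> all (fun p => gadj p.1 p.2) (zip s (rot 1 s)) ->
  gcycle [set e in [seq [set p.1; p.2] | p <- zip s (rot 1 s)]].
Proof.
move=> s_uniq s_gt2; case def_s: s s_gt2 (s_uniq) => [//|x0 s'] s_gt2 _.
rewrite -def_s => s_adj; pose a (i : 'I_(size s)) := nth x0 s i.
have size_zip_rot : size (zip s (rot 1 s)) = size s.
  by rewrite size_zip size_rot minnn.
have nth_rot1 i : (i < size s)%N -> nth x0 (rot 1 s) i = nth x0 s (i.+1 %% size s).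
  move=> i_lt; rewrite def_s rot1_cons nth_rcons /=.
  move: i_lt; rewrite def_s /= ltnS leq_eqVlt => /predU1P[->|i_lt].
    by rewrite ltnn eqxx modnn.
  by rewrite i_lt modn_small.
have nth_zip_rot i : (i < size s)%N ->
    nth (x0, x0) (zip s (rot 1 s)) i = (nth x0 s i, nth x0 s (i.+1 %% size s)).
  by move=> i_lt; rewrite nth_zip ?size_rot // nth_rot1.
exists (size s), a; split.
- by rewrite def_s.
- by move=> i j /eqP; rewrite nth_uniq // => /eqP/val_inj.
- move=> i; have := all_nthP (x0, x0) s_adj i; rewrite size_zip_rot => /(_ (ltn_ord i)).
  by rewrite nth_zip_rot.
- apply/setP => e; rewrite inE; apply/mapP/imsetP => [[p]|[i _ ->]].
    case/(nthP (x0, x0)) => i; rewrite size_zip_rot => i_lt <- ->.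
    by exists (Ordinal i_lt) => //; rewrite nth_zip_rot.
  exists (a i, a (ordS i)) => //; apply/(nthP (x0, x0)); exists i.
    by rewrite size_zip_rot.
  by rewrite nth_zip_rot.
Qed.

Section Hub.
Variables (G : hypergraph) (v : vert G).
Hypothesis G2 : uniform 2 G.
Let E2 := uniformP 2 G G2.

Let adj_neq (a b : vert G) : gadj a b -> a != b. Proof. exact: edge_neq. Qed.

Definition hub_nbrs := [set u | gadj v u].
Definition hub_far := [set z | (z != v) && ~~ gadj v z].
(** The common neighbours of [y] and [v]. For [y != v], a pair of them is a 4-cycle in which [y] is
    opposite to [v], hence the binomials below. *)
Definition nbrs_in (y : vert G) := [set u in hub_nbrs | gadj y u].
Definition nbrs_off (y : vert G) := [set w | gadj y w && (w != v)].
(** A triangle through [v] is recorded by its edge opposite to [v]. *)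
Definition hub_triangles := [set e in edges G | e \subset hub_nbrs].

Lemma hub_neq u : u \in hub_nbrs -> u != v.
Proof. by rewrite inE eq_sym => /adj_neq. Qed.

Let triangle (e : {set vert G}) := e |: [set [set v; u] | u in e].
Let square (p : vert G * {set vert G}) :=
  [set [set p.1; u] | u in p.2] :|: [set [set v; u] | u in p.2].
Let squares := [set p : vert G * {set vert G} |
  [&& p.1 != v, p.2 \subset nbrs_in p.1 & #|p.2| == 2%N]].

Let card_squares : #|squares| = (\sum_(y | y != v) 'C(#|nbrs_in y|, 2))%N.
Proof.
rewrite -sum1_card.
transitivity (\sum_(p : vert G * {set vert G} | (p.1 != v) &&
  ((p.2 \subset nbrs_in p.1) && (#|p.2| == 2%N))) 1)%N.
  by apply: eq_bigl => p; rewrite inE.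
rewrite -(pair_big_dep (fun y => y != v)
  (fun y (A : {set vert G}) => (A \subset nbrs_in y) && (#|A| == 2%N)) (fun _ _ => 1%N)) /=.
apply: eq_bigr => y _; rewrite -cards_draws -sum1_card.
by apply: eq_bigl => A; rewrite inE.
Qed.

Let spokes (c : {set {set vert G}}) := [set u | [set v; u] \in c].

Let mem_spokes (A : {set vert G}) u :
  ([set v; u] \in [set [set v; w] | w in A]) = (u \in A).
Proof.
by apply/imsetP/idP => [[w wA /set2_injr->//]|uA]; exists u.
Qed.

Let spokes_triangle e : e \in hub_triangles -> spokes (triangle e) = e.
Proof.
rewrite inE => /andP[eG e_sub]; apply/setP => u.
rewrite inE in_setU1 mem_spokes; case: eqP => //= vu.
have := set21 v u; rewrite vu => /(subsetP e_sub)/hub_neq.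
by rewrite eqxx.
Qed.

Let spokes_square p : p \in squares -> spokes (square p) = p.2.
Proof.
rewrite inE => /and3P[yv /subsetP A_sub _]; apply/setP => u.
rewrite inE in_setU mem_spokes; case: imsetP => //= -[w wA vu].
have := set21 v u; rewrite vu !inE eq_sym (negPf yv) /= => /eqP vw.
have := A_sub _ wA; rewrite inE => /andP[/hub_neq].
by rewrite -vw eqxx.
Qed.

Let gcycle_triangle e : e \in hub_triangles -> gcycle (triangle e).
Proof.
rewrite inE => /andP[eG e_sub].
have /card_gt0P[a ae] : (0 < #|e|)%N by rewrite (E2 eG).
have [b ba eE] := card2_setP (E2 eG) ae.
have be : b \in e by rewrite eE set22.
have ab : gadj a b by rewrite /gadj -eE.
have va : gadj v a by have := subsetP e_sub _ ae; rewrite inE.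
have vb : gadj v b by have := subsetP e_sub _ be; rewrite inE.
have -> : triangle e = [set f in [seq [set p.1; p.2] | p <- zip [:: v; a; b] (rot 1 [:: v; a; b])]].
  apply/setP => f; rewrite [in RHS]inE /triangle eE imsetU1 imset_set1 /= !inE.
  by rewrite (setUC [set b] [set v]); case: (f == _); case: (f == _).
apply: gcycle_seq => //=.
  by rewrite !inE !negb_or (adj_neq va) (adj_neq vb) (adj_neq ab).
by rewrite va ab gadj_sym vb.
Qed.

Let gcycle_square p : p \in squares -> gcycle (square p).
Proof.
case: p => y A; rewrite inE /= => /and3P[yv /subsetP A_sub /eqP A2].
have /card_gt0P[a aA] : (0 < #|A|)%N by rewrite A2.
have [b ba AE] := card2_setP A2 aA.
have bA : b \in A by rewrite AE set22.
have [va ya] : gadj v a /\ gadj y a by have := A_sub _ aA; rewrite !inE => /andP[].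
have [vb yb] : gadj v b /\ gadj y b by have := A_sub _ bA; rewrite !inE => /andP[].
have -> : square (y, A) = [set f in [seq [set p.1; p.2] |
    p <- zip [:: v; a; y; b] (rot 1 [:: v; a; y; b])]].
  apply/setP => f; rewrite [in RHS]inE /square /= AE !imsetU1 !imset_set1 !inE.
  rewrite (setUC [set a] [set y]) (setUC [set b] [set v]).
  by case: (f == _); case: (f == _); case: (f == _); case: (f == _).
apply: gcycle_seq => //=.
  rewrite !inE !negb_or (adj_neq va) (adj_neq vb) (adj_neq yb) eq_sym yv.
  by rewrite eq_sym (adj_neq ya) eq_sym ba.
by rewrite va (gadj_sym a) ya yb (gadj_sym b) vb.
Qed.

Hypothesis cycles_le3 : forall X : {set {set {set vert G}}},
  (forall c, c \in X -> gcycle c) -> (#|X| <= 3)%N.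

(* Triangles and 4-cycles through [v] are told apart by their edges at [v] and,
   for 4-cycles with the same edges at [v], by the opposite vertex. *)
Lemma short_cycles_le3 (X : {set {set {set vert G}}}) :
  (forall c, c \in X ->
     gcycle c /\ exists2 f, f \in c & forall a, a \in f -> [set v; a] \notin c) ->
  (#|hub_triangles| + \sum_(y | y != v) 'C(#|nbrs_in y|, 2) + #|X| <= 3)%N.
Proof.
move=> X_far; rewrite -card_squares.
have triangle_inj : {in hub_triangles &, injective triangle}.
  by move=> e f /spokes_triangle eE /spokes_triangle fE ef; rewrite -eE ef fE.
have square_inj : {in squares &, injective square}.
  move=> [y A] [y' A'] pS p'S eq_sq.
  have AA' : A = A' by have := spokes_square pS; rewrite eq_sq spokes_square.
  subst A'; congr (_, _); move: (pS) (p'S).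
  rewrite !inE /= => /and3P[yv /subsetP A_sub /eqP A2] /and3P[y'v _ _].
  have /card_gt0P[a aA] : (0 < #|A|)%N by rewrite A2.
  have : [set y; a] \in square (y', A) by rewrite -eq_sq; apply/setUP; left; apply: imset_f.
  have yu u : u \in A -> y != u by move/A_sub; rewrite inE => /andP[_ /adj_neq].
  rewrite inE => /orP[] /imsetP[/= u uA yaE]; have := set21 y a; rewrite yaE !inE.
    by rewrite (negPf (yu u uA)) orbF => /eqP.
  by rewrite (negPf (yu u uA)) orbF (negPf yv).
pose X1 := triangle @: hub_triangles; pose X2 := square @: squares.
(* In a triangle or 4-cycle through [v] every edge has an end that the cycle joins to [v]. The
   members of [X] possess an edge without such an end, so they are further cycles. *)
have near_X c f : c \in X1 :|: X2 -> f \in c -> exists2 a, a \in f & [set v; a] \in c.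
  case/setUP => /imsetP[].
    move=> e eT -> /setU1P[->|/imsetP[u ue ->]]; last first.
      by exists u; rewrite ?set22 //; apply/setU1P; right; apply: imset_f.
    have /card_gt0P[a ae] : (0 < #|e|)%N.
      by move: eT; rewrite inE => /andP[/E2->].
    by exists a => //; apply/setU1P; right; apply: imset_f.
  move=> [y A] pS -> /setUP[] /imsetP[u uA ->]; exists u; rewrite ?set22 //;
    by apply/setUP; right; apply: imset_f.
have X12 : [disjoint X1 & X2].
  rewrite -setI_eq0 -subset0; apply/subsetP => c /setIP[/imsetP[e eT ->]].
  case/imsetP => -[y A] pS eq_c; have eA : e = A.
    by have := spokes_triangle eT; rewrite eq_c spokes_square.
  subst A; have : e \in square (y, e) by rewrite -eq_c !inE eqxx.
  move: pS; rewrite inE /= => /and3P[yv /subsetP e_sub /eqP e2].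
  rewrite inE => /orP[] /imsetP[/= u ue eE].
    have : y \in e by rewrite eE set21.
    by move/e_sub; rewrite inE => /andP[_ /adj_neq]; rewrite eqxx.
  have : v \in e by rewrite eE set21.
  by move/e_sub; rewrite inE => /andP[/hub_neq]; rewrite eqxx.
have XX : [disjoint X1 :|: X2 & X].
  rewrite -setI_eq0 -subset0; apply/subsetP => c /setIP[c12 cX].
  have [_ [f fc f_far]] := X_far c cX.
  by have [a af] := near_X c f c12 fc; rewrite (negPf (f_far a af)).
have := cycles_le3 (X := X1 :|: X2 :|: X).
rewrite cardsU (disjoint_setI0 XX) cards0 subn0.
rewrite cardsU (disjoint_setI0 X12) cards0 subn0 !card_in_imset //; apply.
move=> c /setUP[/setUP[]|/X_far[]//] /imsetP[p pS ->].
  exact: gcycle_triangle.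
exact: gcycle_square.
Qed.

End Hub.

(** * Counting edges around the hub *)

Section HubCounting.
Local Open Scope nat_scope.
Variables (G : hypergraph) (v : vert G).
Hypothesis G2 : uniform 2 G.
Let E2 := uniformP 2 G G2.

Let gadj_irr (a : vert G) : gadj a a = false.
Proof. by apply/negbTE/edge_irrefl. Qed.

Lemma big_hub (R : Type) (idx : R) (op : Monoid.com_law idx) (F : vert G -> R) :
  \big[op/idx]_(y | y != v) F y =
  op (\big[op/idx]_(u in hub_nbrs v) F u) (\big[op/idx]_(z in hub_far v) F z).
Proof.
rewrite (bigID (fun y => gadj v y)) /=; congr (op _ _); apply: eq_bigl => y.
  rewrite inE andbC; case: (boolP (gadj v y)) => //= vy.
  by rewrite eq_sym (edge_neq E2 vy).
by rewrite inE.
Qed.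

Lemma sum_hub (F : vert G -> nat) :
  \sum_(y | y != v) F y = \sum_(u in hub_nbrs v) F u + \sum_(z in hub_far v) F z.
Proof. exact: big_hub. Qed.

Lemma card_vert_hub : #|vert G| = 1 + #|hub_nbrs v| + #|hub_far v|.
Proof.
rewrite -[LHS]sum1_card (bigD1 v) //=; have /= -> := sum_hub (fun=> 1).
by rewrite !sum1_card addnA.
Qed.

Lemma card_nbrs (y : vert G) : #|[set w | gadj y w]| = #|nbrs_off v y| + gadj v y.
Proof.
rewrite (cardsD1 v) inE gadj_sym addnC; congr (_ + _); apply: eq_card => w.
by rewrite !inE andbC.
Qed.

(** The sum is twice the number of edges avoiding [v]. With [d] neighbours and [r] far vertices
    there are [(1 + d + r) + 2 - d = r + 3] of them. *)
Lemma sum_nbrs_off : #|edges G| = #|vert G| + 2 ->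
  \sum_(y | y != v) #|nbrs_off v y| = 2 * (#|hub_far v| + 3).
Proof.
move=> kE; have := sum_degrees E2; rewrite kE card_vert_hub (bigD1 v) //=.
under eq_bigr do rewrite card_nbrs.
rewrite big_split /= [X in _ + (_ + X)](_ : _ = #|hub_nbrs v|); last first.
  have /= -> := sum_hub (fun y => gadj v y).
  rewrite [X in _ + X]big1 ?addn0; last by move=> z; rewrite inE => /andP[_ /negPf->].
  by rewrite -sum1_card; apply: eq_bigr => u; rewrite inE => ->.
rewrite -[#|[set b | _]|]/#|hub_nbrs v|; lia.
Qed.

Lemma sum_nbrs_in : \sum_(u in hub_nbrs v) #|nbrs_in v u| = 2 * #|hub_triangles v|.
Proof.
have T2 e : e \in hub_triangles v -> #|e| = 2 by rewrite inE => /andP[/E2].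
rewrite -(sum_degrees T2) [RHS](bigID (mem (hub_nbrs v))) /= [X in _ = _ + X]big1 ?addn0.
  apply: eq_bigr => u uN; apply: eq_card => w.
  by rewrite !inE subUset !sub1set uN inE andbC.
move=> u uN; apply/eqP; rewrite cards_eq0 -subset0; apply/subsetP => w.
by rewrite !inE subUset !sub1set (negPf uN) andbF.
Qed.

Lemma nbrs_off_hub u : u \in hub_nbrs v ->
  #|nbrs_off v u| = #|nbrs_in v u| + #|[set z in hub_far v | gadj u z]|.
Proof.
move=> uN; rewrite -(cardsID (hub_nbrs v)); congr (_ + _); apply: eq_card => w.
  rewrite !inE; case: (boolP (gadj v w)) => vw; rewrite ?andbF // !andbT.
  by rewrite eq_sym (edge_neq E2 vw) andbT.
by rewrite !inE; case: (gadj u w); rewrite ?andbF // !andbT andbC.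
Qed.

Lemma sum_nbrs_off_hub : \sum_(u in hub_nbrs v) #|nbrs_off v u| =
  2 * #|hub_triangles v| + \sum_(z in hub_far v) #|nbrs_in v z|.
Proof.
rewrite (eq_bigr _ nbrs_off_hub) big_split /= sum_nbrs_in; congr (_ + _).
under eq_bigr do rewrite -sum1_card.
under [RHS]eq_bigr do rewrite -sum1_card.
rewrite (exchange_big_dep (mem (hub_far v))) /=.
  apply: eq_bigr => z zF; apply: eq_bigl => u; rewrite !inE (gadj_sym u z).
  by move: zF; rewrite inE => ->.
by move=> u z _; rewrite inE => /andP[].
Qed.

Lemma nbrs_in_off y : nbrs_in v y \subset nbrs_off v y.
Proof.
apply/subsetP => w; rewrite !inE => /andP[/(edge_neq E2) vw ->].
by rewrite eq_sym.
Qed.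

(** Of the [r + 3] edges avoiding [v], the first term counts those inside the neighbourhood of [v]
    and the second those from it to far vertices. *)
Lemma hub_edges_bound : #|edges G| = #|vert G| + 2 ->
  #|hub_triangles v| + \sum_(z in hub_far v) #|nbrs_in v z| <= #|hub_far v| + 3.
Proof.
move=> /sum_nbrs_off; rewrite sum_hub sum_nbrs_off_hub => eq_sum.
have : \sum_(z in hub_far v) #|nbrs_in v z| <= \sum_(z in hub_far v) #|nbrs_off v z|.
  by apply: leq_sum => z _; apply/subset_leq_card/nbrs_in_off.
lia.
Qed.

Lemma nbrs_in_triangles u : u \in hub_nbrs v -> #|nbrs_in v u| <= #|hub_triangles v|.
Proof.
move=> uN; rewrite -(card_in_imset (f := fun w => [set u; w])); last first.
  by move=> w w' _ _ /set2_injr.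
apply/subset_leq_card/subsetP => e /imsetP[w]; rewrite !inE => /andP[vw uw ->].
rewrite -[_ \in edges G]/(gadj u w) uw subUset !sub1set uN.
by rewrite inE.
Qed.

Lemma nbrs_off_hub_le u : u \in hub_nbrs v ->
  #|nbrs_off v u| <= #|nbrs_in v u| + #|hub_far v|.
Proof.
move=> uN; rewrite nbrs_off_hub // leq_add2l subset_leq_card //.
by apply/subsetP => w; rewrite inE => /andP[].
Qed.

Lemma nbrs_off_far_lt z : z \in hub_far v ->
  #|nbrs_off v z| < #|nbrs_in v z| + #|hub_far v|.
Proof.
move=> zF; rewrite -(cardsID (hub_nbrs v)) -addnS leq_add //.
  apply/subset_leq_card/subsetP => w; rewrite !inE => /andP[/andP[-> _] ->].
  by [].
rewrite (cardsD1 z (hub_far v)) zF ltnS subset_leq_card //.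
apply/subsetP => w; rewrite !inE => /and3P[vw zw wv]; rewrite wv vw !andbT.
by apply: contraTneq zw => ->; rewrite gadj_irr.
Qed.

End HubCounting.

(** * Numerical estimates *)

Section Numerics.
Variables (R : realFieldType) (e t : R).

Lemma bernstein_ge0 (a b s : R) (i j k : nat) :
  a <= e <= b -> 0 <= s -> 0 <= (e - a) ^+ i * (b - e) ^+ j * s ^+ k.
Proof.
move=> /andP[ae eb] s_ge0.
by rewrite !mulr_ge0 // exprn_ge0 // subr_ge0.
Qed.

(** The conclusion of [hub_estimate] is affine in [M]; collecting terms turns it into
    [A * M < B]. *)
Let A (r T : R) := (1 + e) ^+ 2 * (2%:R * (r + 3%:R) + (3%:R - T) * (r + 2%:R)) +
  e * t * (r + 3%:R - T).
Let B (r T : R) := t * (r - 1) * (1 + e * t) + (6%:R - 2%:R * T) * (1 + e).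

(* The difference of the two sides of the inequalities proved by these tactics
   has nonnegative coefficients in the Bernstein basis in [e] (of degree 3 or 4,
   on a subinterval of [0, 1]) times the monomial basis in [t - 37 / 5 - e]. *)
Ltac bernstein3 ae s0 :=
  clear - ae s0; let H := fresh "H" in have H := fun i j k => bernstein_ge0 i j k ae s0;
  pose proof (H 0 3 0)%N; pose proof (H 1 2 0)%N; pose proof (H 2 1 0)%N;
  pose proof (H 3 0 0)%N; pose proof (H 0 3 1)%N; pose proof (H 1 2 1)%N;
  pose proof (H 2 1 1)%N; pose proof (H 3 0 1)%N; pose proof (H 0 3 2)%N;
  pose proof (H 1 2 2)%N; pose proof (H 2 1 2)%N; pose proof (H 3 0 2)%N; lra.
Ltac bernstein4 ae s0 :=
  clear - ae s0; let H := fresh "H" in have H := fun i j k => bernstein_ge0 i j k ae s0;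
  pose proof (H 0 4 0)%N; pose proof (H 1 3 0)%N; pose proof (H 2 2 0)%N;
  pose proof (H 3 1 0)%N; pose proof (H 4 0 0)%N; pose proof (H 0 4 1)%N;
  pose proof (H 1 3 1)%N; pose proof (H 2 2 1)%N; pose proof (H 3 1 1)%N;
  pose proof (H 4 0 1)%N; pose proof (H 0 4 2)%N; pose proof (H 1 3 2)%N;
  pose proof (H 2 2 2)%N; pose proof (H 3 1 2)%N; pose proof (H 4 0 2)%N;
  pose proof (H 0 4 3)%N; pose proof (H 1 3 3)%N; pose proof (H 2 2 3)%N;
  pose proof (H 3 1 3)%N; pose proof (H 4 0 3)%N; lra.

(** This is [t] times the bound wanted for [hub_excess], once the weights off the hub are estimated
    through their maximum [M]. The alternative in the last hypothesis is supplied by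
    [second_weight]. *)
Lemma hub_estimate (r T : nat) (M : R) : (2 <= r)%N -> (T <= 3)%N ->
  0 <= e <= 1 -> 37%:R / 5%:R + e <= t -> 0 <= M <= 1 ->
  M * (t - (1 + e) * (r + T)%:R) <= 1 \/ t <= (r + 2)%:R + e * (r + 1)%:R ->
  (1 + e) * (2%:R * T%:R +
    (1 + e) * M * (2%:R * (r%:R + 3%:R) + (3%:R - T%:R) * (r%:R + 2%:R))) +
  e * t * M * (r%:R + 3%:R - T%:R) < t * (r%:R - 1) * (1 + e * t) + 6%:R * (1 + e).
Proof.
move=> r_ge2 T_le3 e01 te M01 MK.
have s0 : 0 <= t - 37%:R / 5%:R - e by lra.
have t_gt0 : 0 < t by lra.
have et_ge0 : 0 <= e * t by apply: mulr_ge0; lra.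
have [r2 T3] : 2%:R <= r%:R :> R /\ T%:R <= 3%:R :> R by rewrite !ler_nat.
have T0 : 0 <= T%:R :> R by rewrite ler0n.
have A_ge0 : 0 <= A r%:R T%:R.
  have T_ge0 : 0 <= (3%:R - T%:R) * (r%:R + 2%:R) :> R by apply: mulr_ge0; lra.
  by rewrite /A addr_ge0 //; apply: mulr_ge0; rewrite ?sqr_ge0 //; lra.
have B_gt0 : 0 < B r%:R T%:R.
  rewrite /B ltr_pwDl //; last by apply: mulr_ge0; lra.
  by apply: mulr_gt0; [apply: mulr_gt0|]; lra.
(* Two ways to remove [M]: by [M <= 1], or by [M K <= 1] with [K = t - (1 + e)(r + T)], which
   replaces [A < B] by [A < B K]. *)
suff AB : A r%:R T%:R < B r%:R T%:R \/
    M * (t - (1 + e) * (r + T)%:R) <= 1 /\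
    A r%:R T%:R < B r%:R T%:R * (t - (1 + e) * (r + T)%:R).
  suff : A r%:R T%:R * M < B r%:R T%:R by rewrite /A /B; lra.
  case: AB => [lt_AB|[MK1 lt_AB]]; first by apply: le_lt_trans lt_AB; nra.
  have [M0|M_gt0] : M = 0 \/ 0 < M by lra.
    by rewrite M0 mulr0.
  apply: (@lt_le_trans _ _ (B r%:R T%:R * (t - (1 + e) * (r + T)%:R) * M)).
    by rewrite ltr_pM2r.
  by rewrite -mulrA (mulrC _ M) ger_pMr.
(* Above the threshold [th] the inequality [A < B] holds, below it [A < B K]. The second alternative
   for [M] gives no [K], so it must force [e] above [th]. *)
have split_at th : th <= 1 -> (t <= (r + 2)%:R + e * (r + 1)%:R -> th <= e) ->
    (th <= e <= 1 -> A r%:R T%:R < B r%:R T%:R) ->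
    (0 <= e <= th -> A r%:R T%:R < B r%:R T%:R * (t - (1 + e) * (r + T)%:R)) ->
    A r%:R T%:R < B r%:R T%:R \/ M * (t - (1 + e) * (r + T)%:R) <= 1 /\
    A r%:R T%:R < B r%:R T%:R * (t - (1 + e) * (r + T)%:R).
  move=> th1 far_th lt_B lt_BK; case: MK => [MK1|/far_th th_e].
    case: (lerP e th) => e_th; [right | left]; first by split=> //; apply: lt_BK; lra.
    by apply: lt_B; lra.
  by left; apply: lt_B; lra.
have [r_lt6|r_ge6] := ltnP r 6; last first.
  left; have ae : 0 <= e <= 1 by [].
  have r6 : 6%:R <= r%:R :> R by rewrite ler_nat.
  (* [B - A] is affine in [r] with this slope, so [r = 6] settles all larger [r]. *)
  have slope : 0 <= t * (1 + e * t) - (1 + e) ^+ 2 * (5%:R - T%:R) - e * t.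
    suff : (1 + e) ^+ 2 * (5%:R - T%:R) <= 5%:R * (1 + e) ^+ 2.
      move=> le5; suff : 0 <= t * (1 + e * t) - 5%:R * (1 + e) ^+ 2 - e * t by lra.
      bernstein3 ae s0.
    by rewrite mulrC ler_wpM2r ?exprn_ge0 //; lra.
  have at6 : A 6%:R T%:R < B 6%:R T%:R.
    by case: T {MK A_ge0 B_gt0 slope split_at T3 T0} T_le3 => [|[|[|[|//]]]] _;
      rewrite /A /B; bernstein3 ae s0.
  have : 0 <= (r%:R - 6%:R) * (t * (1 + e * t) - (1 + e) ^+ 2 * (5%:R - T%:R) - e * t).
    by apply: mulr_ge0; lra.
  move: at6; rewrite /A /B; lra.
(* Sixteen cases, [r = 2, ..., 5] with [T = 0, ..., 3]. Against [t >= 37/5 + e], the second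
   alternative is impossible for [r = 2] and forces [e >= 4/5], [7/20], [2/25] for [r = 3, 4, 5];
   the thresholds stay below these values. *)
case: r r_ge2 r_lt6 {r2} MK A_ge0 B_gt0 split_at => [|[|[|[|[|[|//]]]]]] // _ _;
  case: T T_le3 {T3 T0} => [|[|[|[|//]]]] _ MK A_ge0 B_gt0 split_at;
  rewrite /A /B /= in split_at *.
- by right; split; [case: MK => //; lra | bernstein4 e01 s0].
- by right; split; [case: MK => //; lra | bernstein4 e01 s0].
- apply: (split_at (4%:R / 5%:R)); [lra|lra| |] => ae.
    bernstein3 ae s0.
  bernstein4 ae s0.
- apply: (split_at (1 / 5%:R)); [lra|lra| |] => ae.
    bernstein3 ae s0.
  bernstein4 ae s0.
- apply: (split_at (1 / 2%:R)); [lra|lra| |] => ae.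
    bernstein3 ae s0.
  bernstein4 ae s0.
- apply: (split_at (1 / 5%:R)); [lra|lra| |] => ae.
    bernstein3 ae s0.
  bernstein4 ae s0.
- apply: (split_at (1 / 10%:R)); [lra|lra| |] => ae.
    bernstein3 ae s0.
  bernstein4 ae s0.
- by left; bernstein3 e01 s0.
- apply: (split_at (1 / 5%:R)); [lra|lra| |] => ae.
    bernstein3 ae s0.
  bernstein4 ae s0.
- apply: (split_at (1 / 10%:R)); [lra|lra| |] => ae.
    bernstein3 ae s0.
  bernstein4 ae s0.
- by left; bernstein3 e01 s0.
- by left; bernstein3 e01 s0.
- apply: (split_at (1 / 20%:R)); [lra|lra| |] => ae.
    bernstein3 ae s0.
  bernstein4 ae s0.
- by left; bernstein3 e01 s0.
- by left; bernstein3 e01 s0.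
- by left; bernstein3 e01 s0.
Qed.

End Numerics.

(** * The eigenvalue equation seen from a vertex of maximal weight *)

(** Common neighbours beyond the first are paid for by 4-cycles. *)
Lemma leq_bin2 n : (n <= 1 + 'C(n, 2))%N.
Proof. by case: n => // n; rewrite binS bin1; lia. Qed.

Section HubDegrees.
Local Open Scope nat_scope.
Variables (G : hypergraph) (v : vert G).
Hypothesis G2 : uniform 2 G.
Hypothesis cycles_le3 : forall X : {set {set {set vert G}}},
  (forall c, c \in X -> gcycle c) -> #|X| <= 3.

Lemma hub_cycles_le3 :
  #|hub_triangles v| + \sum_(y | y != v) 'C(#|nbrs_in v y|, 2) <= 3.
Proof.
have := @short_cycles_le3 G v G2 cycles_le3 set0.
by rewrite cards0 addn0; apply => c; rewrite inE.
Qed.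

Lemma bin_nbrs_in_le y : y != v -> #|hub_triangles v| + 'C(#|nbrs_in v y|, 2) <= 3.
Proof.
move=> yv; apply: leq_trans hub_cycles_le3; rewrite leq_add2l (bigD1 y) //=.
exact: leq_addr.
Qed.

Lemma nbrs_in_far_le3 y : y != v -> #|nbrs_in v y| <= 3.
Proof.
move=> /bin_nbrs_in_le le3; rewrite leqNgt; apply/negP => b_gt3.
by have := leq_bin2l 2 b_gt3; rewrite (_ : 'C(4, 2) = 6) //; lia.
Qed.

(** Three common neighbours of [u] and [v] would create three triangles and three 4-cycles. *)
Lemma nbrs_in_hub_le2 u : u \in hub_nbrs v -> #|nbrs_in v u| <= 2.
Proof.
move=> uN; have := bin_nbrs_in_le (hub_neq G2 uN); have := nbrs_in_triangles uN.
move=> b_le le3; rewrite leqNgt; apply/negP => b_gt2.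
by have := leq_bin2l 2 b_gt2; rewrite (_ : 'C(3, 2) = 3) //; lia.
Qed.

Lemma nbrs_off_le y : y != v -> #|nbrs_off v y| <= #|hub_far v| + 2.
Proof.
move=> yv; have [yN|yN] := boolP (y \in hub_nbrs v).
  by have := nbrs_off_hub_le G2 yN; have := nbrs_in_hub_le2 yN; lia.
have yF : y \in hub_far v by rewrite inE yv; move: yN; rewrite inE.
by have := nbrs_off_far_lt G2 yF; have := nbrs_in_far_le3 yv; lia.
Qed.

(** Writing [b] and [D] for the two cardinals at [y], [b D <= D + C(b, 2) (r + 2)]. The first terms
    sum to [2 (r + 3)], and at most [3 - T] 4-cycles are available for the second. *)
Lemma sum_nbrs_in_off : #|edges G| = #|vert G| + 2 ->
  \sum_(y | y != v) #|nbrs_in v y| * #|nbrs_off v y| <=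
  2 * (#|hub_far v| + 3) + (3 - #|hub_triangles v|) * (#|hub_far v| + 2).
Proof.
move=> kE; rewrite -(sum_nbrs_off v G2 kE).
apply: (@leq_trans (\sum_(y | y != v) (#|nbrs_off v y| +
    'C(#|nbrs_in v y|, 2) * (#|hub_far v| + 2)))).
  apply: leq_sum => y yv; have := leq_bin2 #|nbrs_in v y|.
  have := nbrs_off_le yv; nia.
rewrite big_split leq_add2l -big_distrl leq_mul2r; apply/orP; right.
have le3 := hub_cycles_le3.
rewrite -(leq_add2l #|hub_triangles v|) subnKC //.
exact: leq_trans (leq_addr _ _) le3.
Qed.

End HubDegrees.

Section HubSpectrum.
Variables (G : hypergraph) (v : vert G) (R : realFieldType).
Variables (e t : R) (x : vert G -> R).
Hypothesis G2 : uniform 2 G.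
Hypotheses (e01 : 0 <= e <= 1) (te : 37%:R / 5%:R + e <= t).
Hypotheses (x_ge0 : forall y, 0 <= x y) (xv : x v = 1).
Hypothesis x_eig : forall a, t * x a = \sum_(b | gadj a b) x b +
  e * (#|[set b | gadj a b]|%:R - 1) * x a.

Let D y : R := #|nbrs_off v y|%:R.
Let b y : R := #|nbrs_in v y|%:R.
Let d : R := #|hub_nbrs v|%:R.
Let r : R := #|hub_far v|%:R.

Lemma eig_hub u : u \in hub_nbrs v ->
  t * x u = 1 + \sum_(w in nbrs_off v u) x w + e * D u * x u.
Proof.
rewrite inE => vu; have uv : gadj u v by rewrite gadj_sym.
rewrite x_eig (card_nbrs v) // vu natrD -/(D u) (_ : D u + true%:R - 1 = D u);
  last by rewrite /=; lra.
rewrite (bigD1 v) //= xv; congr (_ + _ + _).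
by apply: eq_bigl => w; rewrite inE.
Qed.

Lemma eig_far z : z \in hub_far v ->
  t * x z = \sum_(w in nbrs_off v z) x w + e * (D z - 1) * x z.
Proof.
rewrite inE => /andP[zv /negPf vz].
rewrite x_eig (card_nbrs v) // vz addn0; congr (_ + _).
apply: eq_bigl => w; rewrite inE andbC; case: eqVneq => // ->.
by rewrite gadj_sym vz.
Qed.

(** The part of [t^2] not explained by the degree of [v]: walks of length two ending away from [v],
    and the diagonal terms at the neighbours. *)
Definition hub_excess := \sum_(y | y != v) b y * x y + e * \sum_(u in hub_nbrs v) D u * x u.

Lemma hub_identity : t ^+ 2 - e * t * (d - 1) = d + hub_excess.
Proof.
have sum_off : \sum_(u in hub_nbrs v) \sum_(w in nbrs_off v u) x w =
    \sum_(y | y != v) b y * x y.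
  rewrite (exchange_big_dep (fun w => w != v)) /=; last first.
    by move=> u w _; rewrite inE => /andP[].
  apply: eq_bigr => w wv; rewrite sumr_const mulr_natl; congr (_ *+ _).
  by apply: eq_card => u; rewrite !inE -topredE /= !inE wv andbT (gadj_sym u).
have eq_v : t = \sum_(u in hub_nbrs v) x u + e * (d - 1).
  have := x_eig v; rewrite xv !mulr1 => ->; congr (_ + _).
  by apply: eq_bigl => w; rewrite inE.
have : t * \sum_(u in hub_nbrs v) x u = d + hub_excess.
  rewrite mulr_sumr (eq_bigr _ eig_hub) !big_split /= sum_off sumr_const -/d.
  by rewrite -addrA; congr (_ + (_ + _)); rewrite mulr_sumr; apply: eq_bigr => u _; rewrite mulrA.
nra.
Qed.
(** The solution of [(t - e) c = 1 + c]: the weight of a vertex whose only neighbours are the hub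
    and a partner of the same kind. *)
Let c := 1 / (t - 1 - e).

(* The right-hand side is the value of [hub_excess] for which the vector of
   [T2C_lambda1_gt] becomes an eigenvector. *)
Lemma hub_excess_target dl : hub_excess < (r - 1) * (1 + e * t) + 6%:R * c * (1 + e) + t * dl ->
  t - e * (d + r - 2%:R) < (d + r - 7%:R) / t + 6%:R * c + dl.
Proof.
(* Local copies, since [lra] ignores section hypotheses. *)
have [te' e01'] := (te, e01).
move=> S_lt; have t_gt0 : 0 < t by lra.
have ct : c * t = 1 + (1 + e) * c by rewrite /c; field; apply: lt0r_neq0; lra.
rewrite -(ltr_pM2r t_gt0).
have -> : ((d + r - 7%:R) / t + 6%:R * c + dl) * t =
    d + r - 7%:R + 6%:R * (c * t) + dl * t by field; apply: lt0r_neq0.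
have := hub_identity; rewrite ct; lra.
Qed.

Hypothesis cycles_le3 : forall X : {set {set {set vert G}}},
  (forall c, c \in X -> gcycle c) -> (#|X| <= 3)%N.
Hypothesis kE : (#|edges G| = #|vert G| + 2)%N.
Hypothesis x_le1 : forall y, x y <= 1.
Let T : R := #|hub_triangles v|%:R.

(** [M] is the largest weight off the hub, attained at [y]. A neighbour [y] of [v] sees the hub and
    at most [r + T] weights [M], which bounds [M]. A far [y] sees only weights at most [M], so a
    positive [M] cancels and [t] itself is bounded. *)
Lemma second_weight : (2 <= #|hub_far v|)%N -> exists M : R,
  [/\ 0 <= M <= 1, forall y, y != v -> x y <= M &
    M * (t - (1 + e) * (#|hub_far v| + #|hub_triangles v|)%:R) <= 1 \/
    t <= (#|hub_far v| + 2)%:R + e * (#|hub_far v| + 1)%:R].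
Proof.
have [te' e01'] := (te, e01).
move=> r_ge2; have /card_gt0P[z0 z0F] : (0 < #|hub_far v|)%N by lia.
have z0v : z0 != v by move: z0F; rewrite inE => /andP[].
case: (@Order.TotalTheory.arg_maxP _ _ _ z0 (fun y => y != v) x z0v) => y yv x_max.
have {}x_max w : w != v -> x w <= x y by move/x_max.
have sum_le : \sum_(w in nbrs_off v y) x w <= D y * x y.
  rewrite mulr_natl -sumr_const; apply: ler_sum => w; rewrite inE => /andP[_].
  exact: x_max.
exists (x y); split=> //; first by rewrite x_ge0 x_le1.
have [yN|yN] := boolP (y \in hub_nbrs v).
  left; have := eig_hub yN.
  have : D y <= (#|hub_far v| + #|hub_triangles v|)%:R.
    rewrite ler_nat; have := nbrs_off_hub_le G2 yN; have := nbrs_in_triangles yN; lia.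
  set K : R := _%:R => DK; have := x_ge0 y; have : 0 <= (1 + e) * (K - D y) * x y.
    by rewrite !mulr_ge0 ?subr_ge0 //; lra.
  nra.
have yF : y \in hub_far v by rewrite inE yv; move: yN; rewrite inE.
have := eig_far yF; have := x_ge0 y; rewrite le_eqVlt => /predU1P[<-|xy_gt0] eq_y.
  by left; lra.
right; rewrite -(ler_pM2r xy_gt0).
have DK : D y <= (#|hub_far v| + 2)%:R by rewrite ler_nat nbrs_off_le.
have : 0 <= ((#|hub_far v| + 2)%:R - D y) * x y by rewrite mulr_ge0 ?subr_ge0.
have : 0 <= e * (((#|hub_far v| + 2)%:R - D y) * x y).
  by rewrite mulr_ge0 ?mulr_ge0 ?subr_ge0 //; lra.
rewrite !natrD; nra.
Qed.

Lemma hub_excess_far : (2 <= #|hub_far v|)%N ->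
  hub_excess < (r - 1) * (1 + e * t) + 6%:R * c * (1 + e).
Proof.
have [te' e01'] := (te, e01).
move=> r_ge2; have [M [M01 x_leM MK]] := second_weight r_ge2.
have t_gt0 : 0 < t by lra.
have T3 : (#|hub_triangles v| <= 3)%N by have := hub_cycles_le3 v G2 cycles_le3; lia.
have := hub_estimate r_ge2 T3 e01 te M01 MK; rewrite -/r -/T.
set P : R := (\sum_(z in hub_far v) #|nbrs_in v z|)%:R.
set Q : R := (\sum_(y | y != v) #|nbrs_in v y| * #|nbrs_off v y|)%:R.
have P_le : P <= r + 3%:R - T.
  by rewrite lerBrDl -!natrD ler_nat hub_edges_bound.
have Q_le : Q <= 2%:R * (r + 3%:R) + (3%:R - T) * (r + 2%:R).
  by rewrite -!natrD -natrB // -!natrM -natrD ler_nat sum_nbrs_in_off.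
pose W := \sum_(y | y != v) b y * x y.
have off_le y : \sum_(w in nbrs_off v y) x w <= D y * M.
  rewrite mulr_natl -sumr_const; apply: ler_sum => w; rewrite inE => /andP[_].
  exact: x_leM.
(* Second iteration: the equation at [y] expands each weight occurring in [W]. *)
have x_le y : y != v -> t * x y <= (y \in hub_nbrs v)%:R + D y * ((1 + e) * M).
  move=> yv; have D_ge0 : 0 <= D y by rewrite ler0n.
  have xM : 0 <= e * D y * (M - x y).
    by rewrite !mulr_ge0 ?subr_ge0 ?x_leM //; lra.
  have := off_le y; have [yN|yN] := boolP (y \in hub_nbrs v).
    by rewrite (eig_hub yN) /=; lra.
  have yF : y \in hub_far v by rewrite inE yv; move: yN; rewrite inE.
  rewrite (eig_far yF) /=; have : 0 <= e * x y by rewrite mulr_ge0 //; lra.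
  lra.
have W_le : t * W <= 2%:R * T + (1 + e) * M * Q.
  have -> : 2%:R * T = \sum_(y | y != v) b y * (y \in hub_nbrs v)%:R.
    rewrite -natrM -(sum_nbrs_in v G2) natr_sum.
    rewrite [RHS](bigID (mem (hub_nbrs v))) /= [X in _ + X]big1 ?addr0; last first.
      by move=> y /andP[_ /negPf->]; rewrite mulr0.
    rewrite [RHS](eq_bigl (mem (hub_nbrs v))) /=; last first.
      by move=> y; rewrite andb_idl // => /(hub_neq G2).
    by apply: eq_bigr => u ->; rewrite mulr1.
  rewrite /Q natr_sum !mulr_sumr -big_split /=; apply: ler_sum => y yv.
  have : 0 <= b y * ((y \in hub_nbrs v)%:R + D y * ((1 + e) * M) - t * x y).
    by rewrite mulr_ge0 ?ler0n // subr_ge0 x_le.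
  rewrite natrM -/(b y) -/(D y); lra.
(* For a neighbour [u], [D u - b u] counts its far neighbours, so these differences add up to
   [P]. *)
have S_le : hub_excess <= (1 + e) * W + e * M * P.
  rewrite /hub_excess -/W mulrDl mul1r -addrA lerD2l -mulrA -mulrDr.
  apply: ler_wpM2l; first by lra.
  have -> : M * P = \sum_(u in hub_nbrs v) (D u - b u) * M.
    rewrite -mulr_suml mulrC sumrB /D /b -!natr_sum.
    rewrite (sum_nbrs_off_hub v G2) (sum_nbrs_in v G2) natrD.
    by rewrite /P; congr (_ * _); lra.
  apply: (@le_trans _ _ (\sum_(u in hub_nbrs v) (b u * x u) +
      \sum_(u in hub_nbrs v) (D u - b u) * M)).
    rewrite -big_split /=; apply: ler_sum => u uN.
    have Db : b u <= D u by rewrite ler_nat subset_leq_card ?nbrs_in_off.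
    have : 0 <= (D u - b u) * (M - x u).
      by rewrite mulr_ge0 ?subr_ge0 ?x_leM ?(hub_neq G2).
    lra.
  rewrite lerD2r; apply: ler_sum_subpred => [y|u]; first by rewrite mulr_ge0 ?ler0n.
  exact: hub_neq.
(* The estimate uses the weaker term with [t c] replaced by 1, which keeps it polynomial. *)
have ct : 6%:R * (1 + e) <= t * (6%:R * c * (1 + e)).
  have -> : t * (6%:R * c * (1 + e)) = 6%:R * (1 + e) * (t / (t - 1 - e)).
    by rewrite /c; field; apply: lt0r_neq0; lra.
  by rewrite ler_peMr ?mulr_ge0 ?ler_pdivlMr; lra.
move=> est; rewrite -(ltr_pM2l t_gt0).
have : 0 <= (1 + e) * ((1 + e) * M) * (2%:R * (r + 3%:R) + (3%:R - T) * (r + 2%:R) - Q).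
  by rewrite !mulr_ge0 ?subr_ge0 //; lra.
have : 0 <= e * t * M * (r + 3%:R - T - P).
  by rewrite !mulr_ge0 ?subr_ge0 //; lra.
have : 0 <= (1 + e) * (2%:R * T + (1 + e) * M * Q - t * W).
  by rewrite !mulr_ge0 ?subr_ge0 //; lra.
have : 0 <= t * ((1 + e) * W + e * M * P - hub_excess).
  by rewrite !mulr_ge0 ?subr_ge0 //; lra.
lra.
Qed.

End HubSpectrum.

(** * Graphs with at most one vertex not adjacent to the hub *)

Lemma imset_T2C_ends (V : finType) (f : nat -> V) (j : 'I_9) :
  [set f i | i : 'I_7 in T2C_ends j] =
  nth set0 [:: [set f 0; f 1]; [set f 1; f 2]; [set f 2; f 0];
    [set f 0; f 3]; [set f 3; f 4]; [set f 4; f 0];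
    [set f 0; f 5]; [set f 5; f 6]; [set f 6; f 0]]%N j.
Proof.
have ends_pair (p q : nat) : (p < 7)%N -> (q < 7)%N ->
    (forall i : 'I_7, (i \in T2C_ends j) = ((i : nat) \in [:: p; q])) ->
    [set f i | i : 'I_7 in T2C_ends j] = [set f p; f q].
  move=> p7 q7 ends_pq; apply/setP => y; apply/imsetP/set2P => [[i]|].
    by rewrite ends_pq !inE => /orP[]/eqP-> ->; [left|right].
  by case=> ->; [exists (Ordinal p7)|exists (Ordinal q7)]; rewrite ?ends_pq ?inE ?eqxx ?orbT.
case: j ends_pair => -[|[|[|[|[|[|[|[|[|//]]]]]]]]] ? ends_pair;
  by apply: ends_pair => // i; rewrite inE.
Qed.

Lemma card_T2C_pendant (l : seq nat) :
  #|T2C_pendant l| = (\sum_(i < 7) nth 0 l i)%N.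
Proof.
rewrite card_tagged sumnE big_map big_enum; apply: eq_bigr => i _.
by rewrite card_ord.
Qed.

Section HubIso.
Variables (m : nat) (G : hypergraph) (v : vert G).
Hypotheses (m_ge2 : (2 <= m)%N) (G2 : uniform 2 G).
Let E2 := uniformP 2 G G2.

(** [cs] follows the numbering [v_1, ..., v_7] of [T2C], and [L i] holds the pendant neighbours of
    its entry [i]. The two counts rule out any further vertex or edge. *)
Lemma hiso_friendship (l : seq nat) (L : nat -> {set vert G}) a1 b1 a2 b2 a3 b3 :
  let cs := [:: v; a1; b1; a2; b2; a3; b3] in
  uniq cs -> all (gadj v) (behead cs) -> gadj a1 b1 -> gadj a2 b2 -> gadj a3 b3 ->
  (forall i, (i < 7)%N -> #|L i| = nth 0%N l i) ->
  (forall i i' z, (i < 7)%N -> (i' < 7)%N -> z \in L i -> z \in L i' -> i = i') ->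
  (forall i z, (i < 7)%N -> z \in L i -> z \notin cs /\ gadj (nth v cs i) z) ->
  #|vert G| = (7 + \sum_(i < 7) nth 0 l i)%N -> #|edges G| = (#|vert G| + 2)%N ->
  hiso (T2C m l) (power_hypergraph m G).
Proof.
move=> cs cs_uniq /and5P[va1 vb1 va2 vb2 /and3P[va3 vb3 _]] ab1 ab2 ab3.
move=> L_card L_disj L_adj card_V card_E.
pose pend (p : T2C_pendant l) := nth v (enum (L (tag p))) (tagged p).
have pend_in p : pend p \in L (tag p).
  by rewrite -mem_enum mem_nth // -cardE L_card.
apply: (@hiso_T2C_power m G l (fun i => nth v cs i) pend) => //.
- by move=> i i' /eqP; rewrite nth_uniq // => /eqP/val_inj.
- move=> [i u] [i' u'] /= eq_pend.
  have ii' : i = i'.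
    have := pend_in (existT _ i' u'); rewrite -eq_pend => z_in'.
    by apply/val_inj/(L_disj _ _ _ (ltn_ord i) (ltn_ord i') (pend_in (existT _ i u))).
  subst i'; congr existT; apply/val_inj/eqP.
  have : nth v (enum (L i)) u == nth v (enum (L i)) u' by apply/eqP.
  by rewrite nth_uniq ?enum_uniq // -cardE L_card.
- move=> i p; apply/eqP => eq_ip; have [/negP[]] := L_adj _ _ (ltn_ord (tag p)) (pend_in p).
  by rewrite -eq_ip mem_nth.
- move=> j; rewrite (imset_T2C_ends (nth v cs)).
  case: j => -[|[|[|[|[|[|[|[|[|//]]]]]]]]] ? //=; by rewrite 1?setUC.
- by move=> p; have [] := L_adj _ _ (ltn_ord (tag p)) (pend_in p).
- by rewrite card_T2C_pendant.
- by rewrite card_T2C_pendant card_E card_V; lia.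
Qed.

Hypothesis b_le1 : forall u, u \in hub_nbrs v -> (#|nbrs_in v u| <= 1)%N.

Lemma hub_triangles_disjoint e f a : e \in hub_triangles v -> f \in hub_triangles v ->
  a \in e -> a \in f -> e = f.
Proof.
rewrite !inE => /andP[eE /subsetP eN] /andP[fE /subsetP fN] ae af.
have [b _ eE'] := card2_setP (E2 eE) ae; have [c _ fE'] := card2_setP (E2 fE) af.
have bN : b \in hub_nbrs v by apply: eN; rewrite eE' set22.
have cN : c \in hub_nbrs v by apply: fN; rewrite fE' set22.
have bA : b \in nbrs_in v a by move: bN; rewrite !in_set => ->; rewrite /gadj -eE'.
have cA : c \in nbrs_in v a by move: cN; rewrite !in_set => ->; rewrite /gadj -fE'.
rewrite eE' fE'; congr [set _; _].
exact: (card_le1_eqP (b_le1 (eN _ ae)) _ _ cA bA).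
Qed.

(** The label [a1] is prescribed so that a vertex carrying a pendant edge can be placed at [v_2]. *)
Lemma hub_triangles_labels a1 : #|hub_triangles v| = 3%N ->
  (exists2 e, e \in hub_triangles v & a1 \in e) ->
  exists b1 a2 b2 a3 b3, let cs := [:: v; a1; b1; a2; b2; a3; b3] in
  [/\ uniq cs, all (gadj v) (behead cs), gadj a1 b1, gadj a2 b2 & gadj a3 b3].
Proof.
move=> T3 [e1 e1T a1e1].
have /eqP/cards2P[e2 [e3 [e23 Te1]]] : #|hub_triangles v :\ e1| = 2%N.
  by have := cardsD1 e1 (hub_triangles v); rewrite e1T T3 => -[].
have [e2T e21] : e2 \in hub_triangles v /\ e2 != e1.
  by have : e2 \in hub_triangles v :\ e1; [rewrite Te1 set21 | rewrite in_setD1 => /andP[]].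
have [e3T e31] : e3 \in hub_triangles v /\ e3 != e1.
  by have : e3 \in hub_triangles v :\ e1; [rewrite Te1 set22 | rewrite in_setD1 => /andP[]].
have edge e a : e \in hub_triangles v -> a \in e ->
    exists b, [/\ gadj a b, b \in e, gadj v a & gadj v b].
  rewrite inE => /andP[eE /subsetP eN] ae; have [b _ eE'] := card2_setP (E2 eE) ae.
  have be : b \in e by rewrite eE' set22.
  by exists b; split; rewrite // ?/gadj -?eE' //; [have := eN _ ae|have := eN _ be]; rewrite inE.
have nonempty e : e \in hub_triangles v -> exists a, a \in e.
  by rewrite inE => /andP[/E2 e2' _]; apply/card_gt0P; rewrite e2'.
have [b1 [ab1 b1e1 va1 vb1]] := edge _ _ e1T a1e1.
have [a2 a2e2] := nonempty _ e2T; have [b2 [ab2 b2e2 va2 vb2]] := edge _ _ e2T a2e2.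
have [a3 a3e3] := nonempty _ e3T; have [b3 [ab3 b3e3 va3 vb3]] := edge _ _ e3T a3e3.
exists b1, a2, b2, a3, b3; split=> //; last by rewrite /= va1 vb1 va2 vb2 va3 vb3.
have apart e f a b : e \in hub_triangles v -> f \in hub_triangles v -> e != f ->
    a \in e -> b \in f -> a != b.
  move=> eT fT ef ae bf; apply: contraNneq ef => ab; subst b.
  by apply/eqP/(hub_triangles_disjoint eT fT ae).
have e12 : e1 != e2 by rewrite eq_sym.
have e13 : e1 != e3 by rewrite eq_sym.
rewrite /= !inE !negb_or !(edge_neq E2 va1, edge_neq E2 vb1, edge_neq E2 va2,
  edge_neq E2 vb2, edge_neq E2 va3, edge_neq E2 vb3, edge_neq E2 ab1,
  edge_neq E2 ab2, edge_neq E2 ab3).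
by rewrite !((apart _ _ _ _ e1T e2T e12 a1e1 a2e2), (apart _ _ _ _ e1T e2T e12 a1e1 b2e2),
  (apart _ _ _ _ e1T e2T e12 b1e1 a2e2), (apart _ _ _ _ e1T e2T e12 b1e1 b2e2),
  (apart _ _ _ _ e1T e3T e13 a1e1 a3e3), (apart _ _ _ _ e1T e3T e13 a1e1 b3e3),
  (apart _ _ _ _ e1T e3T e13 b1e1 a3e3), (apart _ _ _ _ e1T e3T e13 b1e1 b3e3),
  (apart _ _ _ _ e2T e3T e23 a2e2 a3e3), (apart _ _ _ _ e2T e3T e23 a2e2 b3e3),
  (apart _ _ _ _ e2T e3T e23 b2e2 a3e3), (apart _ _ _ _ e2T e3T e23 b2e2 b3e3)).
Qed.

End HubIso.

Section NearHub.
Variables (G : hypergraph) (v : vert G).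
Hypothesis G2 : uniform 2 G.
Let E2 := uniformP 2 G G2.
Hypothesis cycles_le3 : forall X : {set {set {set vert G}}},
  (forall c, c \in X -> gcycle c) -> (#|X| <= 3)%N.
Hypothesis kE : (#|edges G| = #|vert G| + 2)%N.

(** The three edges avoiding [v] all close triangles. These exhaust the three cycles, so there is no
    4-cycle, the triangles meet only in [v], and the other vertices are leaves at [v]. *)
Lemma hub_spanning m : (2 <= m)%N -> #|hub_far v| = 0%N -> (7 <= #|vert G|)%N ->
  hiso (T2C m [:: #|vert G| - 7]%N) (power_hypergraph m G).
Proof.
move=> m_ge2 r0 V7.
have [T3 P0] : #|hub_triangles v| = 3%N /\ (\sum_(z in hub_far v) #|nbrs_in v z| = 0)%N.
  have := sum_nbrs_off v G2 kE; rewrite sum_hub // sum_nbrs_off_hub // r0.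
  by move/eqP: r0; rewrite cards_eq0 => /eqP->; rewrite !big_set0; lia.
have b_le1 u : u \in hub_nbrs v -> (#|nbrs_in v u| <= 1)%N.
  move=> uN; have := bin_nbrs_in_le G2 cycles_le3 (hub_neq G2 uN); rewrite T3.
  by case: #|_| => [|[|n]] //; rewrite binS bin1; lia.
have [a1 a1T] : exists a1, exists2 e, e \in hub_triangles v & a1 \in e.
  have /card_gt0P[e eT] : (0 < #|hub_triangles v|)%N by rewrite T3.
  have /card_gt0P[a ae] : (0 < #|e|)%N by move: eT; rewrite inE => /andP[/E2 ->].
  by exists a, e.
have [b1 [a2 [b2 [a3 [b3 [cs_uniq cs_adj ab1 ab2 ab3]]]]]] :=
  hub_triangles_labels G2 b_le1 T3 a1T.
set cs := [:: v; a1; b1; a2; b2; a3; b3] in cs_uniq cs_adj.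
have card_cs : #|[set z in cs]| = 7%N.
  by rewrite cardsE; apply/eqP; have /card_uniqP -> := cs_uniq.
pose L i := if i is 0%N then ~: [set z in cs] else set0.
apply: (@hiso_friendship m G v m_ge2 G2 _ L) cs_uniq cs_adj ab1 ab2 ab3 _ _ _ _ kE.
- move=> [|i] _; last by rewrite /L cards0 /= nth_nil.
  by have := cardsC [set z in cs]; rewrite /L /= card_cs => <-; rewrite addKn.
- by move=> [|i] [|i'] z _ _ //; rewrite /L /= ?in_set0 // => _; rewrite in_set0.
- move=> [|i] z _; rewrite /L ?inE // => z_cs; split=> //=.
  have z_nfar : z \notin hub_far v by move/eqP: r0; rewrite cards_eq0 => /eqP->; rewrite inE.
  move: z_nfar; rewrite inE negb_and !negbK => /predU1P[zv|//].
  by move: z_cs; rewrite zv ?inE eqxx.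
- by rewrite !big_ord_recr big_ord0 /= add0n !addn0 subnKC.
Qed.

Lemma hub_pendant_far m w a1 : (2 <= m)%N -> hub_far v = [set w] -> #|hub_triangles v| = 3%N ->
  (forall u, u \in hub_nbrs v -> (#|nbrs_in v u| <= 1)%N) ->
  a1 \in hub_nbrs v -> gadj a1 w -> (0 < #|nbrs_in v a1|)%N -> (8 <= #|vert G|)%N ->
  hiso (T2C m [:: #|vert G| - 8; 1]%N) (power_hypergraph m G).
Proof.
move=> m_ge2 farE T3 b_le1 a1N a1w /card_gt0P[a1' a1a1'] V8.
have [wv vw] : w != v /\ ~~ gadj v w.
  by have : w \in hub_far v; [rewrite farE set11 | rewrite inE => /andP[]].
have a1T : exists2 e, e \in hub_triangles v & a1 \in e.
  exists [set a1; a1']; rewrite ?set21 // inE subUset !sub1set a1N.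
  by move: a1a1'; rewrite !inE => /andP[-> a]; rewrite -[_ \in edges G]/(gadj a1 a1') a.
have [b1 [a2 [b2 [a3 [b3 [cs_uniq cs_adj ab1 ab2 ab3]]]]]] :=
  hub_triangles_labels G2 b_le1 T3 a1T.
set cs := [:: v; a1; b1; a2; b2; a3; b3] in cs_uniq cs_adj.
have w_cs : w \notin cs.
  rewrite inE negb_or wv; apply: contra vw => w_in.
  exact: (allP cs_adj).
have card_cs : #|w |: [set z in cs]| = 8%N.
  rewrite cardsU1 inE w_cs cardsE; congr (_ + _)%N.
  by apply/eqP; have /card_uniqP -> := cs_uniq.
pose L i := if i is 0%N then ~: (w |: [set z in cs]) else
  if i is 1%N then [set w] else set0.
apply: (@hiso_friendship m G v m_ge2 G2 _ L) cs_uniq cs_adj ab1 ab2 ab3 _ _ _ _ kE.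
- move=> [|[|i]] _; last by rewrite /L cards0 /= nth_nil.
    by have := cardsC (w |: [set z in cs]); rewrite /L /= card_cs => <-; rewrite addKn.
  by rewrite /L cards1.
- move=> [|[|i]] [|[|i']] z _ _ //; rewrite /L ?in_set0 // => zi; rewrite ?in_set0 // => zi'.
    by move: zi; rewrite (set1P zi') !inE eqxx.
  by move: zi'; rewrite (set1P zi) !inE eqxx.
- move=> [|[|i]] z _; rewrite /L ?inE //.
    rewrite negb_or => /andP[zw z_cs]; split=> //=.
    have z_nfar : z \notin hub_far v by rewrite farE inE.
    move: z_nfar; rewrite inE negb_and !negbK => /predU1P[zv|//].
    by move: z_cs; rewrite zv ?inE eqxx.
  by move=> /eqP->; move: w_cs; rewrite !inE => ->.
- by rewrite !big_ord_recr big_ord0 /= add0n !addn0 addn1 -subSn // subSS subnKC 1?ltnW.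
Qed.

(* By cyclomatic count, [w] has one or two neighbours, and in the second case
   they lie in no triangle through [v]. *)
Lemma one_far w : hub_far v = [set w] ->
  [/\ forall u, u \in hub_nbrs v -> (#|nbrs_in v u| <= 1)%N,
      (#|hub_triangles v| + #|nbrs_in v w| = 4)%N &
      #|nbrs_in v w| = 1%N \/ #|nbrs_in v w| = 2%N /\
      forall u, u \in hub_nbrs v -> gadj u w -> #|nbrs_in v u| = 0%N].
Proof.
move=> farE; have r1 : #|hub_far v| = 1%N by rewrite farE cards1.
have wF : w \in hub_far v by rewrite farE set11.
have [wv vw] : w != v /\ ~~ gadj v w by move: wF; rewrite inE => /andP[].
(* Four edges avoid [v]; each either closes a triangle or ends at [w]. *)
have Tb : (#|hub_triangles v| + #|nbrs_in v w| = 4)%N.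
  have := sum_nbrs_off v G2 kE; rewrite sum_hub // sum_nbrs_off_hub // r1 farE !big_set1.
  have := nbrs_off_far_lt G2 wF; rewrite r1.
  by have := subset_leq_card (nbrs_in_off v G2 w); lia.
have le3 := hub_cycles_le3 v G2 cycles_le3.
have le3w := le3; rewrite (bigD1 w) //= in le3w.
have b_le1 u : u \in hub_nbrs v -> (#|nbrs_in v u| <= 1)%N.
  move=> uN; have uw : u != w by apply: contraNneq vw => <-; move: uN; rewrite inE.
  move: le3w; rewrite (bigD1 u) /=; last by rewrite uw (hub_neq G2).
  (* By [Tb], the triangles and the 4-cycles through [w] already number at least three, which leaves
     no 4-cycle with [u] opposite to [v]. *)
  have := leq_bin2 #|nbrs_in v w|.
  move: #|hub_triangles v| #|nbrs_in v w| #|nbrs_in v u| (\sum_(i | _) _)%N Tb.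
  by move=> T bw [|[|n]] X // Tb; rewrite (binS n.+1) bin1; lia.
split=> //; have b_le3 := nbrs_in_far_le3 G2 cycles_le3 wv.
(* Zero or three common neighbours would produce four short cycles: four triangles, or one triangle
   and three 4-cycles. *)
have : #|nbrs_in v w| = 1%N \/ #|nbrs_in v w| = 2%N.
  have C32 : 'C(3, 2) = 3%N by [].
  move: #|hub_triangles v| #|nbrs_in v w| (\sum_(i | _) _)%N Tb b_le3 le3w.
  by move=> T [|[|[|[|//]]]] X Tb _; rewrite ?C32; [lia|left|right|lia].
case=> [|b2]; [by left | right; split=> // u uN uw].
have T2 : #|hub_triangles v| = 2%N by lia.
apply/eqP; rewrite -leqn0 leqNgt; apply/negP => /card_gt0P[u2].
rewrite inE => /andP[u2N uu2].
have vu : gadj v u by move: uN; rewrite inE.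
have vu2 : gadj v u2 by move: u2N; rewrite inE.
have u_in : u \in nbrs_in v w by rewrite inE uN gadj_sym.
have [u' u'u wE] := card2_setP b2 u_in.
have [vu' wu'] : gadj v u' /\ gadj w u'.
  by have : u' \in nbrs_in v w; [rewrite wE set22 | rewrite !inE => /andP[]].
have ww2 : u2 != w by apply: contraNneq vw => <-.
(* Two triangles and the 4-cycle [v u w u'] use up the three cycles, so one more is
   contradictory. *)
have extra c : gcycle c -> (exists2 f, f \in c & forall a, a \in f -> [set v; a] \notin c) ->
    False.
  move=> cyc far_c.
  have far_X c' : c' \in [set c] -> gcycle c' /\
      exists2 f, f \in c' & forall a, a \in f -> [set v; a] \notin c'.
    by move/set1P->.
  have := short_cycles_le3 G2 cycles_le3 far_X.
  by rewrite cards1 T2 (bigD1 w) //= b2 binn addn1 addnA !addSn.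
have neq_vset (a b c : vert G) : b != v -> c != v -> [set v; a] != [set b; c].
  move=> bv cv; apply/eqP => eq_vabc; have := set21 v a.
  by rewrite eq_vabc !inE eq_sym (negPf bv) eq_sym (negPf cv).
have neq_v (a b : vert G) : a != b -> [set v; a] != [set v; b].
  by apply: contraNneq => /set2_injr ->.
have [uv u'v u2v] : [/\ u != v, u' != v & u2 != v].
  by rewrite ![_ == v]eq_sym !(edge_neq E2 vu, edge_neq E2 vu', edge_neq E2 vu2).
(* The vertex [u2] closes a triangle [v u u2]. If [u2 = u'], then [u u' w] is a triangle avoiding
   [v]. Otherwise [v u2 u w u'] is a 5-cycle, and its edge [u w] has no end joined to [v] within
   it. *)
have [u2u'|u2u'] := eqVneq u2 u'.
  subst u2; apply: (extra [set e in [seq [set p.1; p.2] |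
      p <- zip [:: u; u'; w] (rot 1 [:: u; u'; w])]]).
    apply: gcycle_seq => //=; last by rewrite uu2 gadj_sym wu' gadj_sym uw.
    by rewrite !inE !negb_or eq_sym u'u (edge_neq E2 uw) eq_sym (edge_neq E2 wu').
  exists [set u; u']; first by rewrite inE /= !inE eqxx.
  by move=> a _; rewrite inE /= !inE !negb_or !neq_vset.
apply: (extra [set e in [seq [set p.1; p.2] |
    p <- zip [:: v; u2; u; w; u'] (rot 1 [:: v; u2; u; w; u'])]]).
  apply: gcycle_seq => //=.
    rewrite !inE !negb_or (edge_neq E2 vu2) (edge_neq E2 vu) (eq_sym v w) wv (edge_neq E2 vu').
    rewrite (eq_sym u2 u) (edge_neq E2 uu2) ww2 u2u' (edge_neq E2 uw) (eq_sym u) u'u.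
    by rewrite (edge_neq E2 wu').
  by rewrite vu2 (gadj_sym u2) uu2 uw wu' gadj_sym vu'.
exists [set u; w]; first by rewrite inE /= !inE eqxx ?orbT.
move=> a /set2P[]->; rewrite inE /= !inE !negb_or (setUC [set u'] [set v]).
  by rewrite (neq_v u u2) ?(neq_vset u u2 u) ?(neq_vset u u w) ?(neq_vset u w u')
    ?(neq_v u u') ?(edge_neq E2 uu2) // eq_sym.
by rewrite (neq_v w u2) ?(neq_vset w u2 u) ?(neq_vset w u w) ?(neq_vset w w u')
  ?(neq_v w u') ?(edge_neq E2 wu') // eq_sym.
Qed.

End NearHub.

Section OneFar.
Variables (G : hypergraph) (v w : vert G) (R : realFieldType).
Variables (e t : R) (x : vert G -> R).
Hypothesis G2 : uniform 2 G.
Hypotheses (e01 : 0 <= e <= 1) (te : 37%:R / 5%:R + e <= t).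
Hypothesis xv : x v = 1.
Hypothesis x_eig : forall a, t * x a = \sum_(b | gadj a b) x b +
  e * (#|[set b | gadj a b]|%:R - 1) * x a.
Hypothesis farE : hub_far v = [set w].
Hypothesis b_le1 : forall u, u \in hub_nbrs v -> (#|nbrs_in v u| <= 1)%N.
Hypothesis b_far : forall u, u \in hub_nbrs v -> gadj u w -> #|nbrs_in v u| = 0%N.
Let c := 1 / (t - 1 - e).
Let s := \sum_(u in nbrs_in v w) x u.
Let b : R := #|nbrs_in v w|%:R.

Let wF : w \in hub_far v. Proof. by rewrite farE set11. Qed.

Let far_nbrs u : [set z in hub_far v | gadj u z] = if gadj u w then [set w] else set0.
Proof.
apply/setP => z; rewrite farE !inE; case: eqVneq => [->|zw].
  by case: ifP; rewrite !inE ?eqxx.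
by case: ifP; rewrite !inE ?(negPf zw).
Qed.

Let nbrs_off_w : nbrs_off v w = nbrs_in v w.
Proof.
apply/esym/eqP; rewrite eqEcard nbrs_in_off //=.
by have := nbrs_off_far_lt G2 wF; rewrite farE cards1 addn1 ltnS.
Qed.

(** The neighbours of [u] are [v] and a partner [u'] in the same situation. Subtracting their
    equations gives [x u = x u'], and the common value satisfies the equation of [c]. *)
Let weight_in_triangle u : u \in hub_nbrs v -> (0 < #|nbrs_in v u|)%N -> x u = c.
Proof.
move=> uN b_gt0; have [te' e01'] := (te, e01).
have eq_in y : y \in hub_nbrs v -> (0 < #|nbrs_in v y|)%N ->
    exists2 y', nbrs_in v y = [set y'] & t * x y = 1 + x y' + e * x y.
  move=> yN by_gt0.
  have by1 : #|nbrs_in v y| = 1%N by have := b_le1 yN; lia.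
  have yw : gadj y w = false.
    by apply/negP => /(b_far yN); rewrite by1.
  have offE : nbrs_off v y = nbrs_in v y.
    apply/esym/eqP; rewrite eqEcard nbrs_in_off //=.
    by rewrite (nbrs_off_hub G2 yN) far_nbrs yw cards0 addn0.
  have /eqP/cards1P[y' y'E] := by1; exists y' => //.
  by rewrite (eig_hub xv x_eig yN) offE by1 mulr1 y'E big_set1.
have [u' u'E eq_u] := eq_in u uN b_gt0.
have : u' \in nbrs_in v u by rewrite u'E set11.
rewrite inE => /andP[u'N uu'].
have u_in : u \in nbrs_in v u' by rewrite inE uN gadj_sym.
have b'_gt0 : (0 < #|nbrs_in v u'|)%N by apply/card_gt0P; exists u.
have [u2 u2E eq_u'] := eq_in u' u'N b'_gt0.
have u2u : u2 = u by move: u_in; rewrite u2E inE => /eqP.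
subst u2.
have : (t + 1 - e) * (x u - x u') = 0 by lra.
move=> /eqP; rewrite mulf_eq0 => /orP[/eqP|/eqP eq_uu']; first by lra.
have t1e : t - 1 - e != 0 by apply: lt0r_neq0; lra.
by apply: (mulfI t1e); rewrite /c [RHS]mulrC divfK //; lra.
Qed.

(** As no neighbour of [w] lies on a triangle, the excess is computed exactly: each triangle
    supplies two vertices of weight [c], and the remainder depends only on [w] and its
    neighbours. *)
Lemma hub_excess_one_far :
  [/\ hub_excess v e x = 2%:R * (1 + e) * #|hub_triangles v|%:R * c + b * x w + e * s,
      (t - e) * s = b * (1 + x w) & t * x w = s + e * (b - 1) * x w].
Proof.
have triangle_sum : \sum_(u in hub_nbrs v) #|nbrs_in v u|%:R * x u =
    2%:R * #|hub_triangles v|%:R * c.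
  rewrite -natrM -(sum_nbrs_in v G2) natr_sum mulr_suml; apply: eq_bigr => u uN.
  have [->|b_gt0] := posnP #|nbrs_in v u|; first by rewrite !mul0r.
  by rewrite weight_in_triangle.
have far_sum : \sum_(u in hub_nbrs v) #|[set z in hub_far v | gadj u z]|%:R * x u = s.
  rewrite /s [RHS](eq_bigl (fun u => (u \in hub_nbrs v) && gadj u w)); last first.
    by move=> u; rewrite !inE (gadj_sym w).
  rewrite [RHS]big_mkcondr; apply: eq_bigr => u _; rewrite far_nbrs.
  by case: ifP => _; rewrite ?cards1 ?cards0 ?mul1r ?mul0r.
split.
- rewrite /hub_excess (big_hub v G2) farE big_set1 -/b.
  have -> : \sum_(u in hub_nbrs v) #|nbrs_off v u|%:R * x u =
      2%:R * #|hub_triangles v|%:R * c + s.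
    rewrite -triangle_sum -far_sum -big_split /=; apply: eq_bigr => u uN.
    by rewrite (nbrs_off_hub G2 uN) natrD mulrDl.
  by rewrite triangle_sum /=; ring.
- have -> : b * (1 + x w) = \sum_(u in nbrs_in v w) (1 + x w).
    by rewrite sumr_const mulr_natl.
  rewrite mulr_sumr; apply: eq_bigr => u; rewrite inE gadj_sym => /andP[uN uw].
  have b0 := b_far uN uw.
  have off1 : #|nbrs_off v u| = 1%N by rewrite (nbrs_off_hub G2 uN) b0 far_nbrs uw cards1.
  have offE : nbrs_off v u = [set w].
    have /eqP/cards1P[y yE] := off1; rewrite yE; congr [set _].
    have : w \in nbrs_off v u by move: wF; rewrite !inE uw => /andP[->].
    by rewrite yE inE => /eqP.
  by have := eig_hub xv x_eig uN; rewrite off1 offE big_set1; lra.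
- rewrite (eig_far x_eig wF) nbrs_off_w; congr (_ + _).
Qed.

End OneFar.

Section T2CConditions.
Variables (R : realFieldType) (e t : R).
Hypotheses (e01 : 0 <= e <= 1) (te : 37%:R / 5%:R + e <= t).
Let c := 1 / (t - 1 - e).

(* Moving the pendant vertex [w] from a leaf to a triangle of the hub gains more
   at the triangle than is lost at the leaf. *)
Lemma one_far_pendant b s xw : b = 1 -> (t - e) * s = b * (1 + xw) ->
  t * xw = s + e * (b - 1) * xw ->
  2%:R * (1 + e) * 3%:R * c + b * xw + e * s <
  6%:R * c * (1 + e) + t * ((e + t^-1) * c / (t - 2%:R * e - t^-1)).
Proof.
have [te' e01'] := (te, e01).
move=> -> eq_s eq_w.
have t_gt0 : 0 < t by lra.
have ti_gt0 : 0 < t^-1 by rewrite invr_gt0.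
have ti_lt1 : t^-1 < 1 by rewrite invf_lt1 //; lra.
have c_gt0 : 0 < c by rewrite /c divr_gt0 //; lra.
have xwE : xw = s / t by apply: (mulfI (lt0r_neq0 t_gt0)); rewrite eq_w; field; apply: lt0r_neq0.
have sE : s = 1 / (t - e - t^-1).
  have den : t - e - t^-1 != 0 by apply: lt0r_neq0; lra.
  by apply: (mulIf den); rewrite divfK //; move: eq_s; rewrite xwE; lra.
have ct : 1 < t * c.
  by rewrite /c mulrA mulr1 ltr_pdivlMr; lra.
(* The triangle terms cancel and both sides contain the factor [e + t^-1]. What remains is [1 / (t -
   e - t^-1) < t c / (t - 2 e - t^-1)], true as [t c > 1]. *)
suff : 1 * xw + e * s < t * ((e + t^-1) * c / (t - 2%:R * e - t^-1)) by lra.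
have -> : 1 * xw + e * s = (e + t^-1) * s by rewrite xwE; ring.
have -> : t * ((e + t^-1) * c / (t - 2%:R * e - t^-1)) =
    (e + t^-1) * (t * c / (t - 2%:R * e - t^-1)) by ring.
have den : 0 < t - 2%:R * e - t^-1 by lra.
rewrite ltr_pM2l ?sE; last by lra.
apply: (@le_lt_trans _ _ (1 / (t - 2%:R * e - t^-1))).
  by rewrite !mul1r lef_pV2 ?posrE; lra.
by rewrite ltr_pM2r ?invr_gt0.
Qed.

(** The two neighbours of [w] together weigh less than two vertices of a triangle: [2 xw < s] turns
    the first equation into [(t - 1 - e) s < 2], that is [s < 2 c]. *)
Lemma one_far_square b s xw : b = 2%:R -> (t - e) * s = b * (1 + xw) ->
  t * xw = s + e * (b - 1) * xw ->
  2%:R * (1 + e) * 2%:R * c + b * xw + e * s < 6%:R * c * (1 + e).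
Proof.
have [te' e01'] := (te, e01).
move=> -> eq_s eq_w.
have te_gt2 : 0 < t - e by lra.
have c_gt0 : 0 < c by rewrite /c divr_gt0 //; lra.
have xwE : xw = s / (t - e).
  by apply: (mulfI (lt0r_neq0 te_gt2)); rewrite [RHS]mulrC divfK ?lt0r_neq0 //; lra.
have xw_le : xw * (t - e) = s by rewrite xwE divfK ?lt0r_neq0.
have s_gt0 : 0 < s.
  rewrite ltNge; apply/negP => s_le0.
  have : xw * (t - e) <= 0 by lra.
  rewrite pmulr_lle0 // => xw_le0.
  have : (t - e) * s >= (t - e) * (xw * (t - e)) by rewrite xw_le.
  have : (t - e) ^+ 2 >= 2%:R by nra.
  nra.
have xw_gt0 : 0 < xw by rewrite xwE divr_gt0.
have xw_lt : 2%:R * xw < s by nra.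
suff s_lt : s < 2%:R * c by nra.
rewrite /c mulrA mulr1 ltr_pdivlMr; last by lra.
nra.
Qed.

End T2CConditions.

(** * Comparison of spectral radii *)

Lemma card_vert_hiso H1 H2 : hiso H1 H2 -> #|vert H1| = #|vert H2|.
Proof. by case=> f f_bij _; apply: bij_eq_card f_bij. Qed.

Lemma card_edges_hiso H1 H2 : hiso H1 H2 -> #|edges H1| = #|edges H2|.
Proof.
case=> f f_bij <-; rewrite card_imset //.
exact/imset_inj/bij_inj.
Qed.

Lemma card_vert_power m G :
  #|vert (power_hypergraph m G)| = (#|vert G| + #|edges G| * (m - 2))%N.
Proof. by rewrite card_sum card_prod card_sig card_ord. Qed.

Lemma card_edges_power m G : #|edges (power_hypergraph m G)| = #|edges G|.
Proof.
rewrite /= card_imset ?card_sig // => e f ef.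
apply: val_inj; apply/setP => a.
by rewrite -(@mem_power_edge m G e (inl a)) ef mem_power_edge.
Qed.

(** Transporting a Perron vector avoids permuting matrices. If [l2 < l1], it is a strict subsolution
    for the midpoint, which [lambda1_gt] then places below [l2]. *)
Lemma lambda1_hiso_le (C : numClosedFieldType) (m : nat) H1 H2 : (2 <= m)%N ->
  (0 < #|vert H1|)%N -> hiso H1 H2 -> lambda1 C m H1 <= lambda1 C m H2.
Proof.
move=> m_ge2 /card_gt0P[z1 _] iso12.
have [g g_bij gE] := hiso_sym iso12.
have [l1 [x [l1E x_ge0 [z z_gt0] x_eig]]] := perron_vector C m_ge2 z1.
have [f _ _] := iso12.
have [l2 [_ [l2E _ _ _]]] := perron_vector C m_ge2 (f z1).
have l1_ge0 : 0 <= l1.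
  have : 0 <= (m - 1)%:R * l1 * x z by rewrite -x_eig sumr_ge0.
  by rewrite pmulr_lge0 // pmulr_rge0 // ltr0n subn_gt0.
have l2_ge0 : 0 <= l2.
  have : 0 <= val l2 by rewrite l2E; apply: spectral_radius_ge0.
  by [].
suff : l1 <= l2 by move=> le12; rewrite -l1E -l2E.
rewrite leNgt; apply/negP => lt21.
have [g1 gK g1K] := g_bij.
have : val ((l1 + l2) / 2%:R) < lambda1 C m H2.
  have m1_gt0 : 0 < (m - 1)%:R :> realC C by rewrite ltr0n subn_gt0.
  apply: (@lambda1_gt _ _ _ m_ge2 (x \o g)) => //; first by lra.
  - by move=> w; apply: x_ge0.
  - move=> w; rewrite (adj_sum_hiso x w g_bij gE) x_eig /=.
    by rewrite -[leLHS]mulrA -[leRHS]mulrA ler_pM2l // ler_wpM2r //; lra.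
  - exists (g1 z); rewrite (adj_sum_hiso x (g1 z) g_bij gE) x_eig /= g1K.
    by rewrite -[ltLHS]mulrA -[ltRHS]mulrA ltr_pM2l // ltr_pM2r //; lra.
rewrite -l2E => lt_mid; have : (l1 + l2) / 2%:R < l2 by [].
lra.
Qed.

Section Comparison.
Variables (C : numClosedFieldType) (m k : nat).
Let R := realC C.
Hypotheses (m_ge2 : (2 <= m)%N) (km : (46 <= (k - 13) * (m - 1))%N).

(* The test vector of [T2C_lambda1_gt] for the star with [k - 4] edges. *)
Lemma T2C_lambda1_gt_star (s t : R) : let n : R := (m - 2)%:R in
  (m - 1)%:R * s = t + n -> t < 37%:R / 5%:R + n / (t + n + 1) ->
  val s < lambda1 C m (T2C m [:: k - 10; 1]%N).
Proof.
move=> n.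
have n_ge0 : 0 <= n by rewrite ler0n.
have n1E : (m - 1)%:R = n + 1 :> R by rewrite /n natr1; congr _%:R; lia.
have star (s0 t0 : R) : (m - 1)%:R * s0 = t0 + n -> 0 < t0 ->
    t0 ^+ 2 + n * t0 < 55%:R + 9%:R * n ->
    val s0 < lambda1 C m (T2C m [:: k - 10; 1]%N).
  move=> s0E t0_gt0 t0_lt; have tn_gt0 : 0 < t0 + n + 1 by lra.
  have ti_gt0 : 0 < t0^-1 by rewrite invr_gt0.
  have e_ge0 : 0 <= n / (t0 + n + 1) by rewrite divr_ge0 // ltW.
  have tti : t0 * t0^-1 = 1 by rewrite divff ?lt0r_neq0.
  have eti : 0 <= n / (t0 + n + 1) * t0^-1 by rewrite mulr_ge0 // ltW.
  apply: (@T2C_lambda1_gt C m _ s0 t0 t0^-1 0) => //; rewrite -/n.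
  - exact: ltW.
  - by rewrite mulrBl tti; lra.
  - have : 0 <= t0^-1 * t0^-1 by rewrite mulr_ge0 // ltW.
    by rewrite addr0 !mulrBl tti; lra.
  set q : R := (k - 10)%:R.
  (* With weights [1 / t0] the hub condition is [t0^2 + n t0 < (q + 6)(n + 1)], and by [km] the
     right side is at least [46 + 9 (n + 1) = 55 + 9 n]. *)
  have qn : 46%:R + 3%:R * (n + 1) <= q * (n + 1).
    rewrite -n1E /q -!natrM -natrD ler_nat; nia.
  rewrite -(ltr_pM2r t0_gt0) -(ltr_pM2r tn_gt0).
  have -> : (t0 - n / (t0 + n + 1) * (q + 5%:R)) * t0 * (t0 + n + 1) =
      t0 ^+ 2 * (t0 + n + 1) - n * t0 * (q + 5%:R) by field; apply: lt0r_neq0.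
  have -> : (q / t0 + 6%:R / t0 + 0) * t0 * (t0 + n + 1) = (q + 6%:R) * (t0 + n + 1).
    by field; apply: lt0r_neq0.
  have : 0 < (t0 + 1) * ((q + 6%:R) * (n + 1) - t0 ^+ 2 - n * t0).
    by apply: mulr_gt0; lra.
  lra.
(* The vector needs a positive parameter; for [t <= 1] the parameter 1 is used instead, which
   corresponds to some [s1 >= s]. *)
move=> sE t_lt; have [t_le1|t_gt1] := lerP t 1.
  have m1_neq0 : (m - 1)%:R != 0 :> R by rewrite n1E; apply: lt0r_neq0; lra.
  pose s1 : R := (1 + n) / (m - 1)%:R.
  have s_le : s <= s1.
    by rewrite /s1 ler_pdivlMr; [rewrite mulrC; lra | rewrite n1E; lra].
  have : val s1 < lambda1 C m (T2C m [:: k - 10; 1]%N).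
    by apply: (star s1 1); rewrite ?ltr01 //; [rewrite /s1 mulrC divfK | lra].
  exact: le_lt_trans.
apply: (star s t) => //; first by lra.
have tn_gt0 : 0 < t + n + 1 by lra.
have {}t_lt : (t - 37%:R / 5%:R) * (t + n + 1) < n.
  by rewrite -ltr_pdivlMr //; lra.
rewrite ltNge; apply/negP => t_ge.
(* [t_lt] expands to [t^2 + n t < (32 t + 42 n + 37) / 5], at most [55 + 9 n] exactly when
   [32 t <= 238 + 3 n]. A larger [t] violates [t_lt]. *)
have [t_le|t_gt] := lerP (32%:R * t) (238%:R + 3%:R * n); first by lra.
have : 0 <= n * n by rewrite mulr_ge0.
have : 0 <= (n - 1) ^+ 2 by rewrite sqr_ge0.
nra.
Qed.

Lemma power_T2C_comparison (G : hypergraph) (s t : R) (x : vert G -> R) :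
  let n : R := (m - 2)%:R in let e := n / (t + n + 1) in
  uniform 2 G -> #|vert G| = (k - 2)%N -> #|edges G| = k ->
  (forall X : {set {set {set vert G}}}, (forall c, c \in X -> gcycle c) -> (#|X| <= 3)%N) ->
  0 <= s -> (m - 1)%:R * s = t + n -> 37%:R / 5%:R + e <= t ->
  (forall a, 0 <= x a) -> (exists a, 0 < x a) ->
  (forall a, t * x a = \sum_(b | gadj a b) x b +
     e * (#|[set b | gadj a b]|%:R - 1) * x a) ->
  [\/ hiso (T2C m [:: k - 9]%N) (power_hypergraph m G),
      hiso (T2C m [:: k - 10; 1]%N) (power_hypergraph m G) |
      val s < lambda1 C m (T2C m [:: k - 10; 1]%N)].
Proof.
move=> n e G2 cardV cardE cycles_le3 s_ge0 sE te x_ge0 [a0 a0_gt0] x_eig.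
have k14 : (14 <= k)%N by nia.
have [V7 V8] : (7 <= #|vert G|)%N /\ (8 <= #|vert G|)%N by rewrite cardV; lia.
have [k9 k10] : (#|vert G| - 7 = k - 9)%N /\ (#|vert G| - 8 = k - 10)%N by rewrite cardV; lia.
have n_ge0 : 0 <= n by rewrite ler0n.
have kE : #|edges G| = (#|vert G| + 2)%N by rewrite cardE cardV; lia.
have tn_gt0 : 0 < t + n + 1.
  have : 0 <= (m - 1)%:R * s by rewrite mulr_ge0 ?ler0n.
  by rewrite sE; lra.
have e_ge0 : 0 <= e by rewrite /e divr_ge0 // ltW.
have t_gt0 : 0 < t by lra.
have e01 : 0 <= e <= 1 by rewrite e_ge0 /e ler_pdivrMr //; lra.
have [v x_max] : exists v, forall a, x a <= x v.
  case: (@Order.TotalTheory.arg_maxP _ _ _ a0 xpredT x isT) => v _ v_max.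
  by exists v => a; apply: v_max.
have xv_gt0 : 0 < x v := lt_le_trans a0_gt0 (x_max a0).
pose y a := x a / x v.
have y_ge0 a : 0 <= y a by rewrite divr_ge0.
have yv : y v = 1 by rewrite /y divff ?lt0r_neq0.
have y_le1 a : y a <= 1 by rewrite /y ler_pdivrMr // mul1r.
have y_eig a : t * y a = \sum_(b | gadj a b) y b +
    e * (#|[set b | gadj a b]|%:R - 1) * y a.
  by rewrite /y mulrA x_eig mulrDl mulr_suml mulrA.
have card_hub : (#|hub_nbrs v| + #|hub_far v| = k - 10 + 7)%N.
  have := card_vert_hub v G2; rewrite cardV.
  by move: #|hub_nbrs v| #|hub_far v| => d r; clear -k14; lia.
pose c : R := 1 / (t - 1 - e).
have c_gt0 : 0 < c by rewrite /c divr_gt0 //; lra.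
have tec : (t - e) * c = 1 + c.
  by rewrite /c; field; apply: lt0r_neq0; lra.
have ti_gt0 : 0 < t^-1 by rewrite invr_gt0.
have ti_lt1 : t^-1 < 1 by rewrite invf_lt1 //; lra.
(* By [(t - e) c = 1 + c], the condition at [v_2] reduces to this bound on [dl]. The pendant case
   takes equality; elsewhere [dl = 0] suffices. *)
have conclude dl : 0 <= dl -> (t - 2%:R * e - t^-1) * dl <= (e + t^-1) * c ->
    hub_excess v e y < (#|hub_far v|%:R - 1) * (1 + e * t) + 6%:R * c * (1 + e) + t * dl ->
    val s < lambda1 C m (T2C m [:: k - 10; 1]%N).
  move=> dl_ge0 dl_le lt_S.
  apply: (@T2C_lambda1_gt C m _ s t c dl) => //; rewrite -/n -/e.
  - exact: ltW.
  - by rewrite tec.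
  - by rewrite mulrDr; lra.
  have := hub_excess_target e01 te yv y_eig lt_S.
  have -> : #|hub_nbrs v|%:R = (k - 10)%:R + 7%:R - #|hub_far v|%:R :> R.
    by apply/eqP; rewrite eq_sym subr_eq -!natrD card_hub.
  set r : R := #|hub_far v|%:R; set q : R := (k - 10)%:R.
  have -> : q + 7%:R - r + r - 2%:R = q + 5%:R by ring.
  by have -> : q + 7%:R - r + r - 7%:R = q by ring.
have far_case : (2 <= #|hub_far v|)%N -> val s < lambda1 C m (T2C m [:: k - 10; 1]%N).
  move=> r_ge2; apply: (conclude 0); rewrite ?mulr0 ?addr0 //.
    by rewrite mulr_ge0 ?addr_ge0 // ltW.
  exact: (hub_excess_far G2 e01 te y_ge0 yv y_eig cycles_le3 kE y_le1 r_ge2).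
case r_eq: #|hub_far v| => [|[|r]]; last by constructor 3; apply: far_case; rewrite r_eq.
  constructor 1; rewrite -k9; exact: (hub_spanning G2 cycles_le3 kE m_ge2 r_eq V7).
have /eqP/cards1P[w farE] := r_eq.
have [b_le1 Tb b12] := one_far G2 cycles_le3 kE farE.
case: b12 => [b1|[b2 b_far]]; last first.
  constructor 3; have T2 : #|hub_triangles v| = 2%N by clear -Tb b2; lia.
  have [S_eq eq_s eq_w] := hub_excess_one_far G2 e01 te yv y_eig farE b_le1 b_far.
  apply: (conclude 0) => //; first by rewrite mulr0 mulr_ge0 ?addr_ge0 // ltW.
  rewrite mulr0 addr0.
  rewrite S_eq r_eq subrr mul0r add0r T2.
  apply: (one_far_square e01 te _ eq_s eq_w); by rewrite b2.
have T3 : #|hub_triangles v| = 3%N by clear -Tb b1; lia.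
have /eqP/cards1P[u uE] := b1.
have /andP[uN wu] : (u \in hub_nbrs v) && gadj w u.
  by have : u \in nbrs_in v w; [rewrite uE set11 | rewrite inE].
(* Only the place of [u], the neighbour of [w], is open: on a triangle it gives the target graph,
   off the triangles a strict inequality. *)
have [u_tri|u_pend] := posnP #|nbrs_in v u|; last first.
  constructor 2; rewrite -k10.
  by apply: (hub_pendant_far G2 kE m_ge2 farE T3 b_le1 uN _ u_pend V8); rewrite gadj_sym.
constructor 3.
have b_far u' : u' \in hub_nbrs v -> gadj u' w -> #|nbrs_in v u'| = 0%N.
  move=> u'N u'w; suff -> : u' = u by [].
  by apply/set1P; rewrite -uE inE u'N gadj_sym.
have [S_eq eq_s eq_w] := hub_excess_one_far G2 e01 te yv y_eig farE b_le1 b_far.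
have den_gt0 : 0 < t - 2%:R * e - t^-1 by lra.
apply: (conclude ((e + t^-1) * c / (t - 2%:R * e - t^-1))).
- apply: divr_ge0; last exact: ltW.
  by rewrite mulr_ge0 ?addr_ge0 // ltW.
- by rewrite mulrC divfK // lt0r_neq0.
rewrite S_eq r_eq subrr mul0r add0r T3.
by apply: (one_far_pendant e01 te _ eq_s eq_w); rewrite b1.
Qed.

End Comparison.

Theorem theorem5p2p2 (C : numClosedFieldType) (m k : nat) (H : hypergraph)
    (m_ge2 : (2 <= m)%N)
    (H_power : is_power_hypergraph m H)
    (H_connected : hconnected H)
    (H_uniform : uniform m H)
    (H_linear : linear_hypergraph H)
    (H_3cyclic : three_cyclic H)
    (H_typeII : type_II m H)
    (H_edges : #|edges H| = k)
    (km : (46 <= (k - 13) * (m - 1))%N)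
    (H_neq : ~ hiso H (T2C m [:: k - 9]%N)) :
  lambda1 C m H <= lambda1 C m (T2C m [:: k - 10; 1]%N) /\
  (lambda1 C m H = lambda1 C m (T2C m [:: k - 10; 1]%N) ->
   hiso H (T2C m [:: k - 10; 1]%N)).
Proof.
have k14 : (14 <= k)%N by nia.
have [G G2 isoHP] := H_power.
have cardE : #|edges G| = k by rewrite -H_edges (card_edges_hiso isoHP) card_edges_power.
have cardV : #|vert G| = (k - 2)%N.
  have := eqP H_typeII; rewrite (card_vert_hiso isoHP) card_vert_power cardE H_edges.
  have -> : (k * (m - 1) = k * (m - 2) + k)%N by rewrite -mulnSr; congr (_ * _)%N; lia.
  lia.
have cardH_gt0 : (0 < #|vert H|)%N.
  by rewrite (card_vert_hiso isoHP) card_vert_power cardV; lia.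
suff [isoH|lt_H] : hiso H (T2C m [:: k - 10; 1]%N) \/
    lambda1 C m H < lambda1 C m (T2C m [:: k - 10; 1]%N).
- by split=> // ; apply: lambda1_hiso_le.
- split; first exact: ltW.
  by move=> eq_H; move: lt_H; rewrite eq_H ltxx.
have [g g_bij gE] := hiso_sym isoHP.
have /card_gt0P[z0 _] := cardH_gt0.
have [s [x [sE x_ge0 [z z_gt0] x_eig]]] := perron_vector C m_ge2 z0.
have s_ge0 : 0 <= s.
  have : 0 <= val s by rewrite sE; apply: spectral_radius_ge0.
  by [].
rewrite -sE; pose t := (m - 1)%:R * s - (m - 2)%:R.
have st : (m - 1)%:R * s = t + (m - 2)%:R by rewrite /t subrK.
(* Below the threshold the star inside the target already wins; above it the numerical estimates
   apply. *)
have [t_lt|te] := ltrP t (37%:R / 5%:R + (m - 2)%:R / (t + (m - 2)%:R + 1)).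
  by right; apply: (T2C_lambda1_gt_star m_ge2 km st).
have t_gt0 : 0 < t.
  have tn_ge0 : 0 <= t + (m - 2)%:R by rewrite -st mulr_ge0 ?ler0n.
  have : 0 <= (m - 2)%:R / (t + (m - 2)%:R + 1) by apply: divr_ge0; [exact: ler0n | lra].
  lra.
have y_ge0 w : 0 <= (x \o g) w by apply: x_ge0.
have y_gt0 : exists w, 0 < (x \o g) w.
  by have [g1 _ g1K] := g_bij; exists (g1 z); rewrite /= g1K.
have y_eig w : adj_sum (x \o g) w = (t + (m - 2)%:R) * (x \o g) w.
  by rewrite (adj_sum_hiso x w g_bij gE) x_eig st.
have [u [u_ge0 u_gt0 u_eig]] := power_eigenvector G2 t_gt0 y_ge0 y_gt0 y_eig.
have cycles_le3 (X : {set {set {set vert G}}}) : (forall c, c \in X -> gcycle c) -> (#|X| <= 3)%N.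
  exact: (gcycles_le3 g_bij gE H_3cyclic).
case: (power_T2C_comparison m_ge2 km G2 cardV cardE cycles_le3 s_ge0 st te u_ge0 u_gt0 u_eig).
- by move=> iso9; case: H_neq; apply: hiso_trans isoHP (hiso_sym iso9).
- by move=> iso10; left; apply: hiso_trans isoHP (hiso_sym iso10).
- by right.
Qed.
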